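(* Let $\mathcal{H}=(C,F,D,G,\mathcal{M})$ be a geometric hybrid dynamical system, let $\mathcal{A}\subset\mathcal{M}$ be nonempty and compact, and let $V:\mathcal{M}\to\mathbb{R}_{\ge0}$ define a Lyapunov function candidate on $\mathcal{M}$ with respect to $\mathcal{A}$ for $\mathcal{H}$. The set $\mathcal{A}$ is uniformly globally pre-asymptotically stable for $\mathcal{H}$ if $V$ is proper and one of the following conditions holds: (a) (Strict decrease during flows and jumps) there exist lower semicontinuous functions $\rho_{\mathrm C},\rho_{\mathrm D}\in\mathcal{PD}(\mathcal{A})$ such that $$\dot V(x)\le-\rho_{\mathrm C}(x)\quad\forall x\in C,\qquad(1)$$ $$\Delta V(x)\le-\rho_{\mathrm D}(x)\quad\forall x\in D.\qquad(2)$$ (b) (Strict decrease during flows and no increase at jumps) there exists a lower semicontinuous $\rho_{\mathrm C}\in\mathcal{PD}(\mathcal{A})$ such that (1) holds, (2) holds with $\rho_{\mathrm D}\equiv0$, and, for each compact neighborhood $R$ of $\mathcal{A}$, there exist $\gamma\in\mathcal{K}_\infty$ and $N\ge0$ such that, for each solution $\phi\in\widehat{\mathcal{S}}_{\mathcal{H}}(R\setminus\mathcal{A})$, $(t,j)\in\operatorname{dom}\phi$ implies $t\ge\gamma(t+j)-N$. (c) (Strict decrease at jumps and no increase during flows) there exists a lower semicontinuous $\rho_{\mathrm D}\in\mathcal{PD}(\mathcal{A})$ such that (2) holds, (1) holds with $\rho_{\mathrm C}\equiv0$, and, for each compact neighborhood $R$ of $\mathcal{A}$, there exist $\gamma\in\mathcal{K}_\infty$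 and $N\ge0$ such that, for each solution $\phi\in\widehat{\mathcal{S}}_{\mathcal{H}}(R\setminus\mathcal{A})$, $(t,j)\in\operatorname{dom}\phi$ implies $j\ge\gamma(t+j)-N$. (d) (Increase balanced by decrease) there exist constants $\lambda_c,\lambda_d\in\mathbb{R}$ such that $\dot V(x)\le\lambda_cV(x)$ for all $x\in C$ and $\Delta V(x)\le(\exp(\lambda_d)-1)V(x)$ for all $x\in D$, and there exist $M,\gamma>0$ such that, for each solution $\phi$ to $\mathcal{H}$ and each $(t,j)\in\operatorname{dom}\phi$, $\lambda_ct+\lambda_dj\le M-\gamma(t+j)$. (e) (Strict decrease at jumps and bounded time of flow) there exist a lower semicontinuous $\rho_{\mathrm D}\in\mathcal{PD}(\mathcal{A})$ and $\lambda\in\mathbb{R}$ such that (2) holds, $\dot V(x)\le\lambda V(x)$ for each $x\in C$, and, for each compact neighborhood $R$ of $\mathcal{A}$, there exists $T\ge0$ such that each $\phi\in\widehat{\mathcal{S}}_{\mathcal{H}}(R\setminus\mathcal{A})$ satisfies $\sup_t\operatorname{dom}\phi\le T$. (f) (Strict decrease during flows and finite number of jumps) there exist a lower semicontinuous $\rho_{\mathrm C}\in\mathcal{PD}(\mathcal{A})$ and $\lambda\in\mathcal{K}_\infty$ such that (1) holds, $V(\chi)\le\lambda(V(x))$ for each $x\in D$ and each $\chi\in G(x)$, and, for each compact neighborhood $R$ of $\mathcal{A}$, there exists $J>0$ such that each solution $\phi\in\widehat{\mathcal{S}}_{\mathcal{H}}(R\setminus\mathcal{A})$ satisfies $\sup_j\operatorname{dom}\phi\le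 J$.
   Context: **Hybrid systems.** A geometric hybrid dynamical system $\mathcal{H}=(C,F,D,G,\mathcal{M})$ is $\dot x\in F(x)$ for $x\in C$, $x^+\in G(x)$ for $x\in D$, where $\mathcal{M}$ is a finite-dimensional $C^1$-manifold (second countable, Hausdorff), $C,D\subset\mathcal{M}$, $F:\mathcal{M}\rightrightarrows \mathrm{T}\mathcal{M}$ is set-valued with $F(x)\subset \mathrm{T}_x\mathcal{M}$ for each $x$, and $G:\mathcal{M}\rightrightarrows\mathcal{M}$ is set-valued. No other regularity of the data is assumed. **Solutions.** A compact hybrid time domain is a set $\bigcup_{j=0}^{J}[t_j,t_{j+1}]\times\{j\}\subset\mathbb{R}_{\ge0}\times\mathbb{N}$ with $0=t_0\le t_1\le\dots\le t_{J+1}$; a hybrid time domain is a union of compact hybrid time domains $E_0\subset E_1\subset\cdots$. A function $\gamma:I\to\mathcal{M}$ on an interval is locally absolutely continuous if $\psi\circ\gamma$ is locally absolutely continuous for each $C^1$-function $\psi:\mathcal{M}\to\mathbb{R}$. A hybrid arc is a function $\phi:\operatorname{dom}\phi\to\mathcal{M}$, with $\operatorname{dom}\phi$ a hybrid time domain, such that for each $j$, $t\mapsto\phi(t,j)$ is locally absolutely continuous on $I^j=\{t:(t,j)\in\operatorname{dom}\phi\}$. A hybrid arc $\phi$ is a solution to $\mathcal{H}$ if: $\phi(0,0)\in\overline{C}\cup D$; for each $j$ with $\operatorname{int}I^j\ne\varnothing$, $\phi(t,j)\in C$ for all $t\in\operatorname{int}I^j$ and $\frac{d\phi}{dt}(t,j)\in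 F(\phi(t,j))$ for almost all $t\in I^j$; and for each $(t,j)\in\operatorname{dom}\phi$ with $(t,j+1)\in\operatorname{dom}\phi$, $\phi(t,j)\in D$ and $\phi(t,j+1)\in G(\phi(t,j))$. A solution is maximal if it is not the restriction of another solution with strictly larger domain. $\widehat{\mathcal{S}}_{\mathcal{H}}(K)$ (resp. $\mathcal{S}_{\mathcal{H}}(K)$) is the set of all solutions (resp. maximal solutions) with $\phi(0,0)\in K$. $\sup_t\operatorname{dom}\phi=\sup\{t:\exists j,(t,j)\in\operatorname{dom}\phi\}$, $\sup_j\operatorname{dom}\phi=\sup\{j:\exists t,(t,j)\in\operatorname{dom}\phi\}$; $\operatorname{rge}$ is the range. **Functions.** $\mathcal{K}_\infty$: functions $\mathbb{R}_{\ge0}\to\mathbb{R}_{\ge0}$ that are zero at zero, continuous, strictly increasing and unbounded. $\sigma\in\mathcal{PD}(\mathcal{A})$ means $\sigma\ge0$ and $\sigma(x)=0$ iff $x\in\mathcal{A}$ (here for functions on $\mathcal{M}$). $V$ is proper if $\{x:V(x)\le c\}$ is compact for each $c\in\mathbb{R}$. A compact neighborhood of $\mathcal{A}$ is a compact set whose interior contains $\mathcal{A}$. **Stability.** A nonempty compact $\mathcal{A}$ is: uniformly Lyapunov stable if for each neighborhood $U$ of $\mathcal{A}$ there is a neighborhood $W$ of $\mathcal{A}$ such that $\operatorname{rge}\phi\subset U$ for each $\phi\in\mathcal{S}_{\mathcal{H}}(W)$; uniformly Lagrange stable if for each compact neighborhood $W$ of $\mathcal{A}$ there is a compact neighborhood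 $U$ of $\mathcal{A}$ such that $\operatorname{rge}\phi\subset U$ for each $\phi\in\mathcal{S}_{\mathcal{H}}(W)$; uniformly globally stable if both hold; uniformly globally pre-attractive if for all compact neighborhoods $U,W$ of $\mathcal{A}$ there is $N\ge0$ such that for each $\phi\in\mathcal{S}_{\mathcal{H}}(U)$, $(t,j)\in\operatorname{dom}\phi$ and $t+j\ge N$ imply $\phi(t,j)\in W$; uniformly globally pre-asymptotically stable if it is uniformly globally stable and uniformly globally pre-attractive. **Lyapunov function candidate.** Given nonempty $\mathcal{U},\mathcal{A}\subset\mathcal{M}$, $V:\operatorname{dom}V\to\mathbb{R}$ defines a Lyapunov function candidate on $\mathcal{U}$ with respect to $\mathcal{A}$ for $\mathcal{H}$ if: 1) $(\overline C\cup D\cup G(D))\cap\mathcal{U}\subset\operatorname{dom}V$; 2) $\mathcal{U}$ contains an open neighborhood of $\mathcal{A}\cap(C\cup D\cup G(D))$; 3) $V$ is continuous on $\mathcal{U}$ and locally Lipschitz on an open set containing $\overline C\cup\mathcal{U}$; 4) $V$ restricted to $\overline{C\cup D\cup G(D)}$ is positive definite with respect to $\mathcal{A}$ (i.e. there $V\ge 0$, and $V(x)=0$ iff $x\in\mathcal{A}$). In the theorem $\mathcal{U}=\mathcal{M}$. A real function is locally Lipschitz on an open subset of $\mathcal{M}$ if near each point it is locally Lipschitz in some coordinate chart. **Derivatives.** For $S\subset\mathbb{R}^n$, $x\in S$, $\mathrm{T}_S(x)$ is the set of $w$ for which there are $x_i\in S$, $x_i\to x$, $\tau_i\searrow0$ ($\tau_i>0$)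 with $w=\lim(x_i-x)/\tau_i$. For $S\subset\mathcal{M}$, $x\in S$, $\mathrm{T}^{\mathcal{M}}_S(x)=(\mathrm{d}\varphi_x)^{-1}(\mathrm{T}_{\varphi(S\cap U)}(\varphi(x)))$ for any chart $(U,\varphi)$ at $x$. For $V$ locally Lipschitz and $v\in\mathrm{T}_x\mathcal{M}$, $V^\circ(x,v)=\limsup_{y\to x,\,t\searrow0}\frac{\widetilde V(\varphi(y)+t\,\mathrm{d}\varphi_x(v))-\widetilde V(\varphi(y))}{t}$, with $\widetilde V=V\circ\varphi^{-1}$ and $(U,\varphi)$ any chart at $x$ (both are independent of the chart). Then $\dot V(x)=\sup_{v\in F(x)\cap\mathrm{T}^{\mathcal{M}}_C(x)}V^\circ(x,v)$ for $x\in C$ and $\Delta V(x)=\sup_{g\in G(x)}V(g)-V(x)$ for $x\in D$. *)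

(* Defs.v *)
From mathcomp Require Export all_boot all_order all_algebra.
From mathcomp Require Export all_classical all_reals all_analysis.

Set Implicit Arguments.
Unset Strict Implicit.
Unset Printing Implicit Defensive.

Export Order.TTheory GRing.Theory Num.Theory.
Export numFieldNormedType.Exports.

Local Open Scope classical_set_scope.
Local Open Scope ring_scope.

(** * C^1 manifolds *)

(* On a finite-dimensional space, continuity of [x |-> 'd f x] for the operator
   norm is the same as continuity of [x |-> 'd f x v] for every vector [v].
   Only used for open sets [O]. *)
Definition C1_on (R : realType) (n : nat) (W : normedModType R)
    (O : set 'rV[R]_n) (f : 'rV[R]_n -> W) : Prop :=
  forall x, O x ->
    differentiable f x /\ forall v, {for x, continuous (fun y => 'd f y v)}.

(* [chart_fun] and [chart_inv] are total; only their values on [chart_dom] and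
   on its image are meaningful. *)
Record chart (R : realType) (n : nat) (T : topologicalType) := Chart {
  chart_dom : set T;
  chart_fun :> T -> 'rV[R]_n;
  chart_inv : 'rV[R]_n -> T;
  chart_dom_open : open chart_dom;
  chart_img_open : open (chart_fun @` chart_dom);
  chart_funK : forall x, chart_dom x -> chart_inv (chart_fun x) = x;
  chart_fun_continuous :
    forall x, chart_dom x -> {for x, continuous chart_fun};
  chart_inv_continuous :
    forall y, (chart_fun @` chart_dom) y -> {for y, continuous chart_inv} }.

Record C1manifold (R : realType) (n : nat) := C1Manifold {
  mfd_carrier :> topologicalType;
  mfd_hausdorff : hausdorff_space mfd_carrier;
  mfd_second_countable : @second_countable mfd_carrier;
  atlas : set (chart R n mfd_carrier);
  atlas_cover : forall x, exists c, atlas c /\ chart_dom c x;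
  atlas_C1 : forall c d, atlas c -> atlas d ->
    C1_on (c @` (chart_dom c `&` chart_dom d)) (d \o chart_inv c) }.

Record chart_at (R : realType) (n : nat) (M : C1manifold R n) (x : M) :=
  ChartAt {
    chart_at_chart :> chart R n M;
    chart_at_atlas : atlas chart_at_chart;
    chart_at_dom : chart_dom chart_at_chart x }.

Definition chart_of (R : realType) (n : nat) (M : C1manifold R n) (x : M) :
    chart_at x :=
  let c := cid (atlas_cover x) in ChartAt (proj1 (svalP c)) (proj2 (svalP c)).

(* A tangent vector at [x] is the family of its coordinate expressions in the
   charts at [x], related by the differentials of the transition maps:
   [tcoord v c] is the image of [v] under the differential at [x] of [c]. *)
Record tangent (R : realType) (n : nat) (M : C1manifold R n) (x : M) :=
  Tangent {
    tcoord : chart_at x -> 'rV[R]_n;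
    tcoordP : forall c d : chart_at x,
      tcoord d = 'd (d \o chart_inv c : 'rV[R]_n -> 'rV[R]_n) (c x) (tcoord c) }.

Definition C1_function (R : realType) (n : nat) (M : C1manifold R n)
    (psi : M -> R) : Prop :=
  forall c, atlas c -> C1_on (c @` chart_dom c) (psi \o chart_inv c).

Definition locally_lipschitz_on (R : realType) (n : nat) (M : C1manifold R n)
    (O : set M) (V : M -> R) : Prop :=
  forall x, O x -> exists c : chart_at x,
    exists2 B, nbhs (c x) B & [lipschitz V (chart_inv c y) | y in B].

(** * Tangent cones and generalized derivatives *)

Definition tangent_cone (R : realType) (n : nat) (S : set 'rV[R]_n)
    (x : 'rV[R]_n) : set 'rV[R]_n :=
  [set w | exists (xs : nat -> 'rV[R]_n) (tau : nat -> R),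
    [/\ forall i, S (xs i), xs @ \oo --> x,
        forall i, 0 < tau i, tau @ \oo --> (0 : R)
      & (fun i => (tau i)^-1 *: (xs i - x)) @ \oo --> w]].

(* The choice of the chart at [x] is irrelevant here and in [clarke_deriv]. *)
Definition tangent_cone_mfd (R : realType) (n : nat) (M : C1manifold R n)
    (S : set M) (x : M) : set (tangent x) :=
  let c := chart_of x in
  [set v | tangent_cone (c @` (S `&` chart_dom c)) (c x) (tcoord v c)].
Arguments tangent_cone_mfd {R n M} S x _.

Definition clarke_deriv (R : realType) (n : nat) (M : C1manifold R n)
    (V : M -> R) (x : M) (v : tangent x) : \bar R :=
  let c := chart_of x in
  limf_esup
    (fun p : 'rV[R]_n * R =>
      ((V (chart_inv c (p.1 + p.2 *: tcoord v c)) - V (chart_inv c p.1))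
        / p.2)%:E)
    (filter_prod (nbhs (c x)) (0 : R)^'+).

(** * Absolutely continuous curves *)

Definition abs_continuous (R : realType) (a b : R) (f : R -> R) : Prop :=
  forall e, 0 < e -> exists2 d, 0 < d &
    forall (m : nat) (u v : 'I_m -> R),
      (forall i, [/\ a <= u i, u i <= v i & v i <= b]) ->
      trivIset setT (fun i => `]u i, v i[%classic) ->
      \sum_(i < m) (v i - u i) < d ->
      \sum_(i < m) `|f (v i) - f (u i)| < e.

Definition loc_abs_continuous (R : realType) (I : set R) (f : R -> R) : Prop :=
  forall a b, a <= b -> `[a, b]%classic `<=` I -> abs_continuous a b f.

Definition loc_abs_continuous_curve (R : realType) (n : nat)
    (M : C1manifold R n) (I : set R) (g : R -> M) : Prop :=
  forall psi : M -> R, C1_function psi -> loc_abs_continuous I (psi \o g).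

(* A curve on an interval is represented by a total function. The derivative
   below is therefore meaningful at interior points of the interval only; this
   is harmless since it is only used almost everywhere. *)
Definition has_velocity (R : realType) (n : nat) (M : C1manifold R n)
    (g : R -> M) (t : R) (v : tangent (g t)) : Prop :=
  forall c : chart_at (g t), is_derive t 1 (c \o g : R -> 'rV[R]_n) (tcoord v c).
Arguments has_velocity {R n M} g t v.

(** * Hybrid systems and their solutions *)

Record hybrid_system (R : realType) (n : nat) (M : C1manifold R n) :=
  HybridSystem {
    flow_set : set M;
    flow_map : forall x : M, set (tangent x);
    jump_set : set M;
    jump_map : M -> set M }.
Arguments flow_map {R n M} h x _.

Definition compact_hybrid_time_domain (R : realType) (E : set (R * nat)) :
    Prop :=
  exists (J : nat) (t : nat -> R),
    [/\ t 0%N = 0, forall j, (j <= J)%N -> t j <= t j.+1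
      & E = [set p | (p.2 <= J)%N /\ t p.2 <= p.1 <= t p.2.+1]].

Definition hybrid_time_domain (R : realType) (E : set (R * nat)) : Prop :=
  exists2 Es : nat -> set (R * nat),
    forall i, compact_hybrid_time_domain (Es i) /\ Es i `<=` Es i.+1
    & E = \bigcup_i Es i.

Definition time_slice (R : realType) (E : set (R * nat)) (j : nat) : set R :=
  [set t | E (t, j)].

(* The values of [arc_fun] outside [arc_dom] are irrelevant. *)
Record hybrid_arc (R : realType) (n : nat) (M : C1manifold R n) := HybridArc {
  arc_dom : set (R * nat);
  arc_fun :> R -> nat -> M;
  arc_domP : hybrid_time_domain arc_dom;
  arc_abs_continuous : forall j,
    loc_abs_continuous_curve (time_slice arc_dom j) (arc_fun ^~ j) }.

Definition arc_range (R : realType) (n : nat) (M : C1manifold R n)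
    (phi : hybrid_arc M) : set M :=
  [set phi p.1 p.2 | p in arc_dom phi].

Definition sup_t (R : realType) (n : nat) (M : C1manifold R n)
    (phi : hybrid_arc M) : \bar R :=
  ereal_sup [set p.1%:E | p in arc_dom phi].

Definition sup_j (R : realType) (n : nat) (M : C1manifold R n)
    (phi : hybrid_arc M) : \bar R :=
  ereal_sup [set (p.2%:R)%:E | p in arc_dom phi].

Record is_solution (R : realType) (n : nat) (M : C1manifold R n)
    (H : hybrid_system M) (phi : hybrid_arc M) : Prop := IsSolution {
  sol_init : (closure (flow_set H) `|` jump_set H) (phi 0 0%N);
  sol_flow_set : forall j, (time_slice (arc_dom phi) j)° !=set0 ->
    forall t, (time_slice (arc_dom phi) j)° t -> flow_set H (phi t j);
  sol_flow_map : forall j, (time_slice (arc_dom phi) j)° !=set0 ->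
    {ae lebesgue_measure, forall t, time_slice (arc_dom phi) j t ->
      exists2 v, flow_map H (phi t j) v & has_velocity (phi ^~ j) t v};
  sol_jump : forall t j, arc_dom phi (t, j) -> arc_dom phi (t, j.+1) ->
    jump_set H (phi t j) /\ jump_map H (phi t j) (phi t j.+1) }.

Definition arc_restricts (R : realType) (n : nat) (M : C1manifold R n)
    (phi psi : hybrid_arc M) : Prop :=
  arc_dom phi `<=` arc_dom psi /\
  forall t j, arc_dom phi (t, j) -> phi t j = psi t j.

Definition is_maximal_solution (R : realType) (n : nat) (M : C1manifold R n)
    (H : hybrid_system M) (phi : hybrid_arc M) : Prop :=
  is_solution H phi /\
  ~ exists psi, [/\ is_solution H psi, arc_restricts phi psi
                  & arc_dom phi `<` arc_dom psi].

Definition solutions_from (R : realType) (n : nat) (M : C1manifold R n)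
    (H : hybrid_system M) (K : set M) : set (hybrid_arc M) :=
  [set phi | is_solution H phi /\ K (phi 0 0%N)].

Definition maximal_solutions_from (R : realType) (n : nat) (M : C1manifold R n)
    (H : hybrid_system M) (K : set M) : set (hybrid_arc M) :=
  [set phi | is_maximal_solution H phi /\ K (phi 0 0%N)].

(** * Stability *)

Definition compact_nbhd (T : topologicalType) (A K : set T) : Prop :=
  compact K /\ A `<=` K°.

Definition uniformly_Lyapunov_stable (R : realType) (n : nat)
    (M : C1manifold R n) (H : hybrid_system M) (A : set M) : Prop :=
  forall U : set M, A `<=` U° -> exists2 W : set M, A `<=` W° &
    forall phi, maximal_solutions_from H W phi -> arc_range phi `<=` U.

Definition uniformly_Lagrange_stable (R : realType) (n : nat)
    (M : C1manifold R n) (H : hybrid_system M) (A : set M) : Prop :=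
  forall W : set M, compact_nbhd A W -> exists2 U : set M, compact_nbhd A U &
    forall phi, maximal_solutions_from H W phi -> arc_range phi `<=` U.

Definition uniformly_globally_stable (R : realType) (n : nat)
    (M : C1manifold R n) (H : hybrid_system M) (A : set M) : Prop :=
  uniformly_Lyapunov_stable H A /\ uniformly_Lagrange_stable H A.

Definition uniformly_globally_pre_attractive (R : realType) (n : nat)
    (M : C1manifold R n) (H : hybrid_system M) (A : set M) : Prop :=
  forall U W : set M, compact_nbhd A U -> compact_nbhd A W ->
  exists2 N : R, 0 <= N &
    forall phi, maximal_solutions_from H U phi ->
    forall t j, arc_dom phi (t, j) -> N <= t + j%:R -> W (phi t j).

Definition uniformly_globally_pre_asymptotically_stable (R : realType)
    (n : nat) (M : C1manifold R n) (H : hybrid_system M) (A : set M) : Prop :=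
  uniformly_globally_stable H A /\ uniformly_globally_pre_attractive H A.

(** * Lyapunov functions *)

(* Functions on the nonnegative reals are represented by functions on [R] of
   which only the restriction to the nonnegative reals matters. *)
Definition class_Koo (R : realType) (f : R -> R) : Prop :=
  [/\ f 0 = 0, {within [set s : R | 0 <= s], continuous f},
      forall s t, 0 <= s -> s < t -> f s < f t
    & forall B, exists2 s, 0 <= s & B < f s].

Definition class_PD (R : realType) (T : Type) (A : set T) (sigma : T -> R) :
    Prop :=
  forall x, 0 <= sigma x /\ (sigma x = 0 <-> A x).

Definition proper_function (R : realType) (T : topologicalType) (V : T -> R) :
    Prop :=
  forall c : R, compact [set x | V x <= c].

Definition jump_image (R : realType) (n : nat) (M : C1manifold R n)
    (H : hybrid_system M) : set M :=
  \bigcup_(x in jump_set H) jump_map H x.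

(* [V] is a function with domain [domV], represented by a total function. *)
Record lyapunov_candidate (R : realType) (n : nat) (M : C1manifold R n)
    (H : hybrid_system M) (U A domV : set M) (V : M -> R) : Prop :=
  LyapunovCandidate {
    lyap_dom : (closure (flow_set H) `|` jump_set H `|` jump_image H) `&` U
      `<=` domV;
    lyap_nbhd : exists O : set M, [/\ open O,
      A `&` (flow_set H `|` jump_set H `|` jump_image H) `<=` O & O `<=` U];
    lyap_continuous : U `<=` domV /\ {within U, continuous V};
    lyap_lipschitz : exists O : set M, [/\ open O,
      closure (flow_set H) `|` U `<=` O, O `<=` domV
      & locally_lipschitz_on O V];
    lyap_posdef : forall x, domV x ->
      closure (flow_set H `|` jump_set H `|` jump_image H) x ->
      0 <= V x /\ (V x = 0 <-> A x) }.

Definition flow_deriv (R : realType) (n : nat) (M : C1manifold R n)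
    (H : hybrid_system M) (V : M -> R) (x : M) : \bar R :=
  ereal_sup [set clarke_deriv V v |
    v in flow_map H x `&` tangent_cone_mfd (flow_set H) x].

Definition jump_diff (R : realType) (n : nat) (M : C1manifold R n)
    (H : hybrid_system M) (V : M -> R) (x : M) : \bar R :=
  (ereal_sup [set (V g)%:E | g in jump_map H x] - (V x)%:E)%E.

(* Main.v *)
From mathcomp Require Import ring lra measurable_realfun.
Require Import Defs.

(** Along a solution, [V] composed with a flow piece is locally absolutely
continuous: the coordinates of a curve in a chart are quotients of two
[C^1] functions on the manifold (a bump function times a coordinate, over the
bump function), and [V] is Lipschitz in the coordinates. At almost every time
the velocity lies in [F] and in the tangent cone of [C], so Clarke's derivative
bounds the two-sided difference quotients of [V] from above; an absolutely
continuous function with such bounds almost everywhere satisfies the integrated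
inequality. Induction along the hybrid time domain then shows that [V] either
has dropped below a level [r] or has decreased at a definite rate, [rho] being
bounded below on the compact sets [r <= V <= c]. Together with the assumptions
on the hybrid times this gives bounds on [V] that are uniform in the solution,
and properness of [V] turns them into stability and attractivity of [A]. *)

Set Implicit Arguments.
Unset Strict Implicit.
Unset Printing Implicit Defensive.

Local Open Scope classical_set_scope.
Local Open Scope ring_scope.

(** * Monotonicity of absolutely continuous functions *)

(** The system data carry no regularity and [V] is only Lipschitz in charts, so no classical chain
    rule for [V] along a solution is at hand. What survives is a one-sided bound: the limsup in
    Clarke's derivative also varies the base point, and this uniformity allows difference quotients
    over intervals around a time instead of intervals starting at it. Such bounds can be glued over
    a compact interval by a supremum argument, which keeps the flow estimates free of integrals. Two
    further constraints shape the second half. Positive definiteness of [V] is given only on the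
    closure of [C], [D] and [G(D)], so sublevel sets of [V] are compared with neighbourhoods of [A]
    inside that closed set only, where solutions stay. And most of the conditions on hybrid times
    concern solutions that start off [A]; those starting in [A] are treated apart, by showing that
    [V] remains zero along them. *)

(** This is real induction: the supremum of the [t] with [P a t] satisfies the relation by the local
    hypothesis there, and the same hypothesis reaches beyond it unless it equals [b]. *)
Lemma interval_chaining (R : realType) (a b : R) (P : R -> R -> Prop) :
  a <= b ->
  (forall u v w, a <= u -> u <= v -> v <= w -> w <= b ->
     P u v -> P v w -> P u w) ->
  (forall t, a <= t <= b -> exists2 d, 0 < d &
     forall u v, a <= u -> v <= b -> t - d < u -> u <= t -> t <= v ->
       v < t + d -> P u v) ->
  P a b.
Proof.
move=> ab Ptrans Ploc.
pose S := [set t | a <= t <= b /\ P a t].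
have Sa : S a.
  split; first by rewrite lexx ab.
  have [|d d0 /(_ a a)] := Ploc a; first by rewrite lexx ab.
  by apply => //; lra.
have supS : has_sup S.
  by split; [exists a | exists b => t [/andP[_ tb] _]].
have aS : a <= sup S by apply: ub_le_sup => //; exact: (proj2 supS).
have Sb : sup S <= b by apply: ge_sup; [exists a | move=> t [/andP[]]].
have [|d d0 Pd] := Ploc (sup S); first by rewrite aS Sb.
have [t [/andP[at_ tb] Pat] tS] := sup_adherent d0 supS.
have tle : t <= sup S.
  apply: ub_le_sup; first exact: (proj2 supS).
  by split => //; rewrite at_ tb.
have ext v : sup S <= v -> v <= b -> v < sup S + d -> P a v.
  move=> Sv vb vd; apply: (Ptrans a t v) => //; first exact: le_trans Sv.
  exact: Pd.
have [bS|Sltb] := leP b (sup S); first by apply: ext => //; lra.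
(* A point strictly beyond the supremum that is still within reach of the local hypothesis. *)
pose v := Num.min b (sup S + d / 2).
have Sv : sup S < v by rewrite lt_min Sltb/=; lra.
have vb : v <= b by rewrite ge_min lexx.
have vd : v <= sup S + d / 2 by rewrite ge_min lexx orbT.
suff : v <= sup S by lra.
apply: ub_le_sup; first exact: (proj2 supS).
by split; [rewrite vb andbT; lra | apply: ext => //; lra].
Qed.

(* The difference quotients are taken between points on both sides of [t], so
   that intervals around [t] can be chained. *)
Definition upper_rate (R : realType) (a b : R) (f : R -> R) (t c : R) : Prop :=
  forall e, 0 < e -> exists2 d, 0 < d & forall u v, a <= u -> v <= b ->
    t - d < u -> u <= t -> t <= v -> v < t + d -> f v - f u <= (c + e) * (v - u).

Lemma upper_rate_le (R : realType) (a b : R) (f : R -> R) (c : R) : a <= b ->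
  (forall t, a <= t <= b -> upper_rate a b f t c) -> f b - f a <= c * (b - a).
Proof.
move=> ab fc; suff H e : 0 < e -> f b - f a <= (c + e) * (b - a).
  apply/ler_addgt0Pr => e e0.
  (* The [+ 1] covers the case [a = b]. *)
  have /H : 0 < e / (b - a + 1) by apply: divr_gt0 => //; lra.
  move=> /le_trans; apply; rewrite mulrDl lerD2l mulrAC ler_pdivrMr; last lra.
  by rewrite ler_pM2l//; lra.
move=> e0; apply: (interval_chaining (P := fun u v =>
  f v - f u <= (c + e) * (v - u))) => //.
  by move=> u v w _ _ _ _ h1 h2; nra.
by move=> t /fc /(_ _ e0).
Qed.

Lemma sum_itv_le_measure (R : realType) (O : set R) m (u v : 'I_m -> R) :
  open O -> (forall i, u i <= v i) ->
  trivIset setT (fun i => `]u i, v i[%classic) ->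
  (forall i, `]u i, v i[%classic `<=` O) ->
  ((\sum_(i < m) (v i - u i))%:E <= lebesgue_measure O)%E.
Proof.
move=> oO uv triv sO.
rewrite -sumEFin (eq_bigr (fun i =>
  (lebesgue_measure : set R -> \bar R) `]u i, v i[%classic)); last first.
  move=> i _; rewrite lebesgue_measure_itv/= lte_fin.
  case: ltP => // vu; have -> : u i = v i by apply/eqP; rewrite eq_le uv.
  by rewrite subrr.
rewrite -measure_bigsetU_ord//=.
apply: le_measure; rewrite ?inE//.
- by apply: bigsetU_measurable => i _; exact: measurable_itv.
- exact: open_measurable.
- by elim/big_ind : _ => // B C BO CO x [/BO|/CO].
Qed.

(** Chaining concatenates lists of intervals from left to right, whereas absolute continuity speaks
    of indexed disjoint families. Sortedness of the list yields disjointness, and the measure of [O]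
    bounds the total length. *)
Lemma abs_continuous_seq (R : realType) (a b : R) (f : R -> R) (e d : R)
    (O : set R) (s : seq (R * R)) :
  (forall (m : nat) (u v : 'I_m -> R),
     (forall i, [/\ a <= u i, u i <= v i & v i <= b]) ->
     trivIset setT (fun i => `]u i, v i[%classic) ->
     \sum_(i < m) (v i - u i) < d ->
     \sum_(i < m) `|f (v i) - f (u i)| < e) ->
  open O -> (lebesgue_measure O < d%:E)%E ->
  (forall p, p \in s -> [/\ a <= p.1, p.1 <= p.2, p.2 <= b &
     `]p.1, p.2[%classic `<=` O]) ->
  pairwise (fun p q : R * R => p.2 <= q.1) s ->
  \sum_(p <- s) (p.2 - p.1) < d /\ \sum_(p <- s) `|f p.2 - f p.1| < e.
Proof.
move=> fac oO Od sP /(pairwiseP (0, 0)) sw.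
rewrite !(big_nth (0, 0)) !big_mkord.
have sI (i : 'I_(size s)) : _ := sP _ (mem_nth (0, 0) (ltn_ord i)).
have triv : trivIset setT (fun i : 'I_(size s) =>
    `](nth (0, 0) s i).1, (nth (0, 0) s i).2[%classic).
  apply/trivIsetP => i j _ _ ij; rewrite -subset0 => x /= [].
  rewrite !in_itv/= => /andP[xi1 xi2] /andP[xj1 xj2].
  have [lt_ij|lt_ji|/ord_inj/eqP] := ltngtP i j; last by rewrite (negbTE ij).
    by have := sw i j (ltn_ord i) (ltn_ord j) lt_ij; lra.
  by have := sw j i (ltn_ord j) (ltn_ord i) lt_ji; lra.
suff sd : \sum_(i < size s) ((nth (0, 0) s i).2 - (nth (0, 0) s i).1) < d.
  by split => //; apply: fac => // i; have [] := sI i.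
rewrite -lte_fin; apply: le_lt_trans Od.
by apply: sum_itv_le_measure => // i; have [] := sI i.
Qed.

(* The exceptional null set is covered by an open set O of measure less than
   the modulus of absolute continuity, and [a, b] is cut into intervals which
   either lie in O or satisfy the rate bound. *)
Lemma abs_continuous_ae_upper_rate_le (R : realType) (a b : R) (f : R -> R)
    (c : R) : a <= b -> abs_continuous a b f ->
  {ae lebesgue_measure, forall t, a < t < b -> upper_rate a b f t c} ->
  f b - f a <= c * (b - a).
Proof.
move=> ab fac aec.
suff H e : 0 < e -> f b - f a <= (c + e) * (b - a) + (e + e).
  apply/ler_addgt0Pr => e e0.
  have /H : 0 < e / (b - a + 2) by apply: divr_gt0 => //; lra.
  move=> /le_trans; apply; set k := e / _.
  have -> : e = k * (b - a + 2) by rewrite /k divfK//; apply: lt0r_neq0; lra.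
  by lra.
move=> e0.
have [d1 d10 fd1] := fac e e0.
(* The second bound makes [|c + e| * d <= e], so that the intervals inside [O] cost at most [e]
   besides the variation of [f] on them. *)
pose d := Num.min d1 (e / (`|c + e| + 1)).
have d0 : 0 < d.
  by rewrite lt_min d10/=; apply: divr_gt0 => //; apply: ltr_wpDl.
have dd1 : d <= d1 by rewrite ge_min lexx.
have ed : `|c + e| * d <= e.
  have h : d <= e / (`|c + e| + 1) by rewrite ge_min lexx orbT.
  apply: le_trans (ler_wpM2l (normr_ge0 _) h) _.
  rewrite mulrA ler_pdivrMr; last by apply: ltr_wpDl.
  by rewrite mulrC ler_pM2l//; lra.
(* The endpoints join the exceptional set because the rate bound is assumed only in the open
   interval. *)
have : lebesgue_measure.-negligible
    (~` [set t | a < t < b -> upper_rate a b f t c] `|` [set a; b]).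
  apply: negligibleU => //; apply: negligibleU; apply/negligibleP => //;
  exact: lebesgue_measure_set1.
move=> [N [mN N0 subN]].
have [|O [oO NO Od]] := lebesgue_regularity_outer mN _ d0.
  by rewrite [X in (X < _)%E]N0 ltry.
have {}Od : (lebesgue_measure O < d%:E)%E.
  have ON : measurable (O `\` N) by apply: measurableD => //; exact: open_measurable.
  have -> : O = N `|` (O `\` N) by rewrite setDUK.
  apply: le_lt_trans (measureU2 _ _ _) _ => //.
  by rewrite [X in (X + _)%E]N0 add0e.
(* The list [s] records the intervals lying in [O]. On those the increment of [f] is charged in
   full, and the term in [|c + e|] compensates for a possibly negative [(c + e) * (v - u)]. *)
pose P u v := exists s : seq (R * R), [/\
  (forall p, p \in s -> [/\ u <= p.1, p.1 <= p.2, p.2 <= v &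
     `]p.1, p.2[%classic `<=` O]),
  pairwise (fun p q : R * R => p.2 <= q.1) s &
  f v - f u <= (c + e) * (v - u) +
    (`|c + e| * \sum_(p <- s) (p.2 - p.1) + \sum_(p <- s) `|f p.2 - f p.1|)].
have [s [sP sw fs]] : P a b.
  apply: interval_chaining => //.
    move=> u v w au uv vw wb [s [sP ss fs]] [r [rP rr fr]].
    exists (s ++ r); split.
    - move=> p; rewrite mem_cat => /orP[/sP[? ? ? ?]|/rP[? ? ? ?]]; split => //;
      lra.
    - rewrite pairwise_cat ss rr !andbT; apply/allrelP => p q ps qr.
      by have [] := sP _ ps; have [] := rP _ qr; lra.
    - by rewrite !big_cat/=; lra.
  move=> t /andP[at_ tb].
  have [tO|tO] := pselect (O t).
    have [d' /= d'0 dO] : nbhs t O by exact: open_nbhs_nbhs.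
    exists d' => // u v au vb tu ut tv vt; exists [:: (u, v)].
    split => //=.
    - move=> p; rewrite inE => /eqP ->/=; split => //; first exact: le_trans tv.
      move=> x/=; rewrite in_itv/= => /andP[ux xv]; apply: dO => /=.
      by rewrite ltr_norml; apply/andP; split; lra.
    - rewrite !big_seq1/=; have uv : 0 <= v - u by lra.
      have := ler_norm (f v - f u); have : 0 <= (c + e + `|c + e|) * (v - u).
        by apply: mulr_ge0 => //; have := lerNnormlW (lexx `|c + e|); lra.
      by lra.
  have tN : ~ N t by move=> /NO.
  have t1 : a < t < b.
    rewrite !lt_neqAle at_ tb !andbT.
    by apply/andP; split; apply/eqP => h; apply/tN/subN; right; rewrite /= h; auto.
  have : upper_rate a b f t c.
    by apply: contrapT => h; apply/tN/subN; left => /= /(_ t1).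
  move=> /(_ _ e0) [d' d'0 h]; exists d' => // u v au vb tu ut tv vt.
  by exists [::]; split => //; rewrite !big_nil mulr0 !addr0; exact: h.
have [|sd se] := @abs_continuous_seq _ a b f e d O s _ oO Od sP sw.
  by move=> m u v uv tr sd; apply: fd1 => //; exact: lt_le_trans dd1.
apply: (le_trans fs); rewrite lerD2l; apply: lerD; last exact: ltW.
by apply: le_trans ed; apply: ler_wpM2l => //; exact: ltW.
Qed.

Lemma ae_lebesgueS (R : realType) (P Q : R -> Prop) :
  (forall t, P t -> Q t) -> {ae @lebesgue_measure R, forall t, P t} ->
  {ae @lebesgue_measure R, forall t, Q t}.
Proof. by move=> PQ; apply: negligibleS; apply: subsetC => t; exact: PQ. Qed.

Lemma upper_rateW (R : realType) (a b a' b' : R) (f : R -> R) (t c c' : R) :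
  a <= a' -> b' <= b -> c <= c' -> upper_rate a b f t c ->
  upper_rate a' b' f t c'.
Proof.
move=> aa bb cc fc e /fc[d d0 fd]; exists d => // u v au vb tu ut tv vt.
apply: le_trans (fd u v _ _ tu ut tv vt) _; [lra|lra|].
by apply: ler_wpM2r; lra.
Qed.

Lemma abs_continuousS (R : realType) (a b a' b' : R) (f : R -> R) :
  a <= a' -> b' <= b -> abs_continuous a b f -> abs_continuous a' b' f.
Proof.
move=> aa bb fac e /fac[d d0 fd]; exists d => // m u v uv.
by apply: fd => i; have [? ? ?] := uv i; split => //; lra.
Qed.

(** A family consisting of a single interval turns absolute continuity into uniform continuity. *)
Lemma abs_continuous_dist (R : realType) (a b : R) (f : R -> R) (e : R) :
  abs_continuous a b f -> 0 < e -> exists2 d, 0 < d &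
    forall s t, a <= s <= b -> a <= t <= b -> `|s - t| < d -> `|f s - f t| < e.
Proof.
move=> fac /fac[d d0 fd]; exists d => // s t /andP[as_ sb] /andP[at_ tb].
wlog st : s t as_ sb at_ tb / t <= s => [hw|].
  have [/hw|/ltW/hw] := leP t s; first exact.
  by rewrite distrC (distrC (f s)); exact.
rewrite ger0_norm ?subr_ge0// => std.
have := fd 1%N (fun=> t) (fun=> s); rewrite !big_ord1; apply => //.
by apply/trivIsetP => i j _ _; rewrite !ord1.
Qed.

(** Charts control a curve only for a short time, so absolute continuity is available only on small
    intervals around [t]. Their shape is the one required for chaining. *)
Definition loc_abs_continuous_at (R : realType) (a b : R) (f : R -> R) (t : R) :
    Prop :=
  exists2 d, 0 < d & forall u v, a <= u -> v <= b -> t - d < u -> u <= t ->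
    t <= v -> v < t + d -> abs_continuous u v f.

Lemma ae_upper_rate_le (R : realType) (a b : R) (f : R -> R) (c : R) :
  a <= b -> (forall t, a <= t <= b -> loc_abs_continuous_at a b f t) ->
  {ae lebesgue_measure, forall t, a < t < b -> upper_rate a b f t c} ->
  f b - f a <= c * (b - a).
Proof.
move=> ab fac fc.
apply: (interval_chaining (P := fun u v => f v - f u <= c * (v - u))) => //.
  by move=> u v w *; lra.
move=> t /fac[d d0 fd]; exists d => // u v au vb tu ut tv vt.
apply: abs_continuous_ae_upper_rate_le; [lra|exact: fd|].
apply: ae_lebesgueS fc => s h /andP[us sv].
by apply: upper_rateW (h _) => //; apply/andP; split; lra.
Qed.

(** Gronwall's argument with the integrating factor [g t = expR (- (l * t))]: the product [g * f]
    has upper rate 0. *)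
Lemma upper_rate_expR (R : realType) (a b : R) (f : R -> R) (l : R) :
  a <= b -> (forall t, 0 <= f t) -> abs_continuous a b f ->
  (forall t, a <= t <= b -> upper_rate a b f t (l * f t)) ->
  f b <= expR (l * (b - a)) * f a.
Proof.
move=> ab f0 fac fl; pose g t := expR (- (l * t)).
have g0 t : 0 < g t by exact: expR_gt0.
pose G := expR (`|l| * (`|a| + `|b|)).
have G0 : 0 < G by exact: expR_gt0.
have gG t : a <= t <= b -> g t <= G.
  move=> /andP[at_ tb]; rewrite ler_expR; apply: (le_trans (ler_norm _)).
  rewrite normrN normrM; apply: ler_wpM2l => //.
  rewrite ler_norml; apply/andP; split.
    by have := ler_norm (- a); have := normr_ge0 b; rewrite normrN; lra.
  by have := ler_norm b; have := normr_ge0 a; lra.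
have : g b * f b - g a * f a <= 0 * (b - a).
  apply: (@upper_rate_le _ _ _ (fun t => g t * f t)) => // t tab e e0.
  (* One [k] is spent on the rate of [f] at [t], the other on replacing [f t] by [f u]; the factor
     [g v <= G] multiplies both. *)
  pose k := e / (2 * G).
  have k0 : 0 < k by rewrite divr_gt0// mulr_gt0.
  have kG : 2 * k * G = e by rewrite /k; field; lra.
  have [d1 d10 fd1] := fl t tab _ k0.
  have l1 : 0 < `|l| + 1 by apply: ltr_wpDl.
  have [d2 d20 fd2] := abs_continuous_dist fac (divr_gt0 k0 l1).
  exists (Num.min d1 d2); first by rewrite lt_min d10.
  move=> u v au vb tu ut tv vt.
  have [d1m d2m] : Num.min d1 d2 <= d1 /\ Num.min d1 d2 <= d2.
    by rewrite !ge_min !lexx orbT.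
  have fuv : f v - f u <= (l * f t + k) * (v - u) by apply: fd1 => //; lra.
  have lft : l * f t - l * f u <= k.
    rewrite -mulrBr; apply: (le_trans (ler_norm _)); rewrite normrM.
    have /ltW h : `|f t - f u| < k / (`|l| + 1).
      apply: fd2 => //; first by apply/andP; split; lra.
      by rewrite ger0_norm; lra.
    apply: le_trans (ler_wpM2l (normr_ge0 _) h) _.
    rewrite mulrCA ler_piMr//; first exact: ltW.
    by rewrite ler_pdivrMr//; lra.
  have guv : g v - g u <= - l * g v * (v - u).
    have -> : g u = g v * expR (l * (v - u)).
      by rewrite -expRD; congr expR; ring.
    by have := expR_ge1Dx (l * (v - u)); have := g0 v; nra.
  have vu : 0 <= v - u by lra.
  (* The increment of the product is [g v * (f v - f u) + f u * (g v - g u)]; bounding the second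
     term uses [0 <= f u]. *)
  have h1 : g v * (f v - f u) <= g v * ((l * f t + k) * (v - u)).
    by apply: ler_wpM2l => //; exact: ltW.
  have h2 : f u * (g v - g u) <= f u * (- l * g v * (v - u)).
    exact: ler_wpM2l.
  have h3 : g v * (v - u) * (l * f t - l * f u) <= g v * (v - u) * k.
    by apply: ler_wpM2l => //; rewrite mulr_ge0// ltW.
  have h4 : g v * (2 * k * (v - u)) <= G * (2 * k * (v - u)).
    apply: ler_wpM2r; first by apply: mulr_ge0 => //; lra.
    by apply: gG; move: tab => /andP[? ?]; apply/andP; split; lra.
  by rewrite -kG; lra.
rewrite mul0r subr_le0 => h.
have -> : f b = expR (l * b) * (g b * f b).
  by rewrite mulrA -expRD subrr expR0 mul1r.
rewrite mulrBr expRD -mulrA; apply: ler_wpM2l => //; exact: expR_ge0.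
Qed.

(** Near a time [s] the function varies little, so the rates [l * f r] holding at almost every [r]
    are below the constant [l * f s + e]. The almost-everywhere lemma for a constant rate then gives
    an upper rate at every [s], as the exponential estimate requires. *)
Lemma ae_upper_rate_expR (R : realType) (a b : R) (f : R -> R) (l : R) :
  a <= b -> (forall t, 0 <= f t) ->
  (forall t, a <= t <= b -> loc_abs_continuous_at a b f t) ->
  {ae lebesgue_measure, forall t, a < t < b -> upper_rate a b f t (l * f t)} ->
  f b <= expR (l * (b - a)) * f a.
Proof.
move=> ab f0 fac fl.
apply: (interval_chaining (P := fun u v => f v <= expR (l * (v - u)) * f u)) => //.
  move=> u v w _ _ _ _ uv vw; apply: (le_trans vw).
  have -> : l * (w - u) = l * (w - v) + l * (v - u) by ring.
  by rewrite expRD -mulrA; apply: ler_wpM2l => //; exact: expR_ge0.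
move=> t /fac[d d0 fd]; exists d => // u v au vb tu ut tv vt.
have {fd}facuv : abs_continuous u v f by exact: fd.
apply: upper_rate_expR => //; first lra.
move=> s /andP[us sv] e e0.
have l1 : 0 < `|l| + 1 by apply: ltr_wpDl.
have [d' d'0 fd'] := abs_continuous_dist facuv (divr_gt0 e0 l1).
exists d' => // x y ux yv sx xs sy ys.
apply: abs_continuous_ae_upper_rate_le; first lra.
  exact: abs_continuousS facuv.
apply: ae_lebesgueS fl => r h /andP[xr ry].
apply: upper_rateW (h _); [lra|lra| |by apply/andP; split; lra].
suff : l * (f r - f s) <= e by lra.
apply: (le_trans (ler_norm _)); rewrite normrM.
have /ltW h' : `|f r - f s| < e / (`|l| + 1).
  apply: fd'; [by apply/andP; split; lra..|].
  by rewrite ltr_norml; apply/andP; split; lra.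
apply: le_trans (ler_wpM2l (normr_ge0 _) h') _.
rewrite mulrCA ler_piMr//; first exact: ltW.
by rewrite ler_pdivrMr//; lra.
Qed.

(** * Continuously differentiable functions on row vectors *)

Section differentials.
Context {R : realType} {V W : normedModType R}.
Implicit Types (f g : V -> W) (x : V).

Lemma differentiable_near_norm f x : differentiable f x ->
  forall e, 0 < e ->
    \forall h \near (0 : V), `|f (h + x) - f x - 'd f x h| <= e * `|h|.
Proof.
move=> /diff_locally/eqaddoP fx e /fx; apply: filterS => h /=.
by rewrite -[(_ - _) h]/(f (h + x) - (f x + 'd f x h)) opprD addrA.
Qed.

Lemma near_norm_differentiable f x (df : {linear V -> W}) : continuous df ->
  (forall e, 0 < e ->
    \forall h \near (0 : V), `|f (h + x) - f x - df h| <= e * `|h|) ->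
  differentiable f x.
Proof.
move=> cdf fx.
have E : f \o shift x = cst (f x) + df +o_ 0 id.
  apply/eqaddoP => e /fx; apply: filterS => h /=.
  by rewrite -[(_ - _) h]/(f (h + x) - (f x + df h)) opprD addrA.
have D := diff_unique cdf E.
by apply/diff_locallyP; rewrite D.
Qed.

Lemma near_eq_differentiable f g x : {near x, f =1 g} ->
  differentiable f x -> differentiable g x.
Proof.
move=> fg fx; apply: (@near_norm_differentiable _ _ ('d f x)).
  exact: diff_continuous.
move=> e e0; rewrite -(nbhs_singleton fg).
have fg0 : \forall h \near (0 : V), f (h + x) = g (h + x).
  have : {near (0 + x), f =1 g} by rewrite add0r.
  rewrite (near_shift 0) /= => H.
  by apply: filterS H => h /=; rewrite subr0 [h + _]addrC add0r addrC.
by apply: filterS2 (differentiable_near_norm fx e0) fg0 => h + <-.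
Qed.

Lemma near_eq_diff f g x v : {near x, f =1 g} ->
  differentiable f x -> 'd g x v = 'd f x v.
Proof.
move=> fg fx; have gx := near_eq_differentiable fg fx.
by rewrite -!deriveE//; apply/esym/near_eq_derive.
Qed.

End differentials.

Lemma continuous_for_sum (R : realType) (T : topologicalType)
    (W : normedModType R) (I : Type) (s : seq I) (F : I -> T -> W) (x : T) :
  (forall i, {for x, continuous (F i)}) ->
  {for x, continuous (fun y => \sum_(i <- s) F i y)}.
Proof.
move=> Fc; elim: s => [|i s IH].
  rewrite (_ : (fun _ => _) = fun=> 0); first exact: cvg_cst.
  by apply/funext => y; rewrite big_nil.
rewrite (_ : (fun _ => _) = fun y => F i y + \sum_(j <- s) F j y).
  exact: cvgD (Fc i) IH.
by apply/funext => y; rewrite big_cons.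
Qed.

Lemma near_eq_continuous_for (T U : topologicalType) (f g : T -> U) (x : T) :
  {near x, f =1 g} -> {for x, continuous f} -> {for x, continuous g}.
Proof.
move=> fg; rewrite /prop_for /continuous_at -(nbhs_singleton fg).
by apply: cvg_trans; apply: near_eq_cvg; apply: filterS fg => y ->.
Qed.

Lemma open_eq_continuous_for (T U : topologicalType) (O : set T) (f g : T -> U)
    (x : T) : open O -> O x -> (forall y, O y -> f y = g y) ->
  {for x, continuous f} -> {for x, continuous g}.
Proof.
move=> oO Ox fg; apply: near_eq_continuous_for.
by apply: filterS (open_nbhs_nbhs (conj oO Ox)) => y /fg.
Qed.

Section C1_calculus.
Context {R : realType}.

Lemma C1_on_eq n (W : normedModType R) (O : set 'rV[R]_n) (f g : 'rV[R]_n -> W) :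
  open O -> (forall x, O x -> f x = g x) -> C1_on O f -> C1_on O g.
Proof.
move=> oO fg fC x Ox.
have fgn y : O y -> {near y, f =1 g}.
  by move=> Oy; apply: filterS (open_nbhs_nbhs (conj oO Oy)) => z /fg.
have dE v y : O y -> 'd g y v = 'd f y v.
  by move=> Oy; apply: (near_eq_diff v (fgn y Oy)); have [] := fC y Oy.
have [fd fc] := fC x Ox; split; first exact: near_eq_differentiable (fgn x Ox) fd.
move=> v; apply: (open_eq_continuous_for oO Ox _ (fc v)) => y Oy.
by apply: esym; exact: dE.
Qed.

Lemma diff_row_sum n (W : normedModType R) (f : 'rV[R]_n -> W) x v :
  'd f x v = \sum_i v 0 i *: 'd f x (delta_mx 0 i).
Proof.
by rewrite [in LHS](row_sum_delta v) linear_sum; apply: eq_bigr => i _; rewrite linearZ.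
Qed.

(** Continuity of a differential is known only along fixed vectors, but the chain rule applies
    ['d g] to the moving vector ['d f y v]. Expanding that vector in the standard basis leaves fixed
    directions with continuous coefficients. *)
Lemma C1_on_comp n m (W : normedModType R) (O : set 'rV[R]_n) (O' : set 'rV[R]_m)
    (f : 'rV[R]_n -> 'rV[R]_m) (g : 'rV[R]_m -> W) :
  open O -> (forall x, O x -> O' (f x)) -> C1_on O f -> C1_on O' g ->
  C1_on O (g \o f).
Proof.
move=> oO OO' fC gC x Ox.
have dfg y : O y -> differentiable f y /\ differentiable g (f y).
  by move=> Oy; split; [have [] := fC y Oy | have [] := gC _ (OO' _ Oy)].
have dE y v : O y -> 'd (g \o f) y v =
    \sum_i ('d f y v) 0 i *: 'd g (f y) (delta_mx 0 i).
  by move=> /dfg[? ?]; rewrite diff_comp//= diff_row_sum.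
split; first by have [? ?] := dfg x Ox; exact: differentiable_comp.
move=> v; apply: (@open_eq_continuous_for _ _ O
  (fun y => \sum_i ('d f y v) 0 i *: 'd g (f y) (delta_mx 0 i)) _ _ oO Ox).
  by move=> y Oy; apply: esym; exact: dE.
have H i : (fun y => ('d f y v) 0 i *: 'd g (f y) (delta_mx 0 i)) @ x -->
    ('d f x v) 0 i *: 'd g (f x) (delta_mx 0 i).
  have [fx /(_ v) fv] := fC x Ox.
  have [_ /(_ (delta_mx 0 i)) gi] := gC _ (OO' _ Ox).
  exact: (cvgZ (continuous_comp fv (@coord_continuous _ 1 m 0 i ('d f x v)))
    (continuous_comp (differentiable_continuous fx) gi)).
exact: continuous_for_sum H.
Qed.

Lemma C1_cst n (O : set 'rV[R]_n) (k : R) : C1_on O (fun=> k).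
Proof.
move=> x _; split; first exact: differentiable_cst.
move=> v; have dE y : 'd (fun=> k : R) y v = 0 :> R.
  by rewrite (diff_cst k y).
by move/funext : dE => ->; exact: cst_continuous.
Qed.

Lemma C1_coord n (O : set 'rV[R]_n) i : C1_on O (fun z => z 0 i : R).
Proof.
move=> x _; split; first exact: differentiable_coord.
move=> v; have @f : {linear 'rV[R]_n -> R}.
  by exists (fun N : 'rV[R]_n => N 0 i); do 2![eexists]; do ?[constructor];
     rewrite ?mxE// => ? *; rewrite ?mxE//; move=> ?; rewrite !mxE.
have fc : continuous f by exact: coord_continuous.
have dE y : 'd (fun z : 'rV_n => z 0 i : R) y v = f v.
  by rewrite -[LHS]/('d f y v) diff_lin.
by move/funext : dE => ->; exact: cst_continuous.
Qed.

Lemma C1_onD n (O : set 'rV[R]_n) (f g : 'rV[R]_n -> R) :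
  open O -> C1_on O f -> C1_on O g -> C1_on O (fun x => f x + g x).
Proof.
move=> oO fC gC x Ox; have [fd fc] := fC x Ox; have [gd gc] := gC x Ox.
split; first exact: (differentiableD fd gd).
move=> v.
have dE y : O y -> 'd (fun x => f x + g x) y v = 'd f y v + 'd g y v.
  move=> Oy; have [fdy _] := fC y Oy; have [gdy _] := gC y Oy.
  exact: (congr1 (fun h : 'rV_n -> R => h v) (diffD fdy gdy)).
have h : {for x, continuous (fun y => 'd f y v + 'd g y v)}.
  exact: (cvgD (fc v) (gc v)).
apply: (open_eq_continuous_for oO Ox _ h) => y Oy.
by apply: esym; exact: dE.
Qed.

Lemma C1_onM n (O : set 'rV[R]_n) (f g : 'rV[R]_n -> R) :
  open O -> C1_on O f -> C1_on O g -> C1_on O (fun x => f x * g x).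
Proof.
move=> oO fC gC x Ox; have [fd fc] := fC x Ox; have [gd gc] := gC x Ox.
split; first exact: (differentiableM fd gd).
move=> v.
have dE y : O y -> 'd (fun x => f x * g x) y v = f y * 'd g y v + g y * 'd f y v.
  move=> Oy; have [fdy _] := fC y Oy; have [gdy _] := gC y Oy.
  exact: (congr1 (fun h : 'rV_n -> R => h v) (diffM fdy gdy)).
have h : {for x, continuous (fun y => f y * 'd g y v + g y * 'd f y v)}.
  exact: (cvgD (cvgM (differentiable_continuous fd) (gc v))
    (cvgM (differentiable_continuous gd) (fc v))).
apply: (open_eq_continuous_for oO Ox _ h) => y Oy.
by apply: esym; exact: dE.
Qed.

Lemma C1_on_sum n m (O : set 'rV[R]_n) (f : 'I_m -> 'rV[R]_n -> R) :
  open O -> (forall i, C1_on O (f i)) -> C1_on O (fun x => \sum_i f i x).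
Proof.
move=> oO fC; elim: (index_enum 'I_m) => [|i s IH].
  by apply: (C1_on_eq oO _ (@C1_cst n O 0)) => x _; rewrite big_nil.
by apply: (C1_on_eq oO _ (C1_onD oO (fC i) IH)) => x _; rewrite big_cons.
Qed.

Lemma C1_on_compR n (O : set 'rV[R]_n) (f : 'rV[R]_n -> R) (h dh : R -> R) :
  open O -> (forall s : R, is_derive s 1 h (dh s)) -> continuous dh -> C1_on O f ->
  C1_on O (fun x => h (f x)).
Proof.
move=> oO hd dhc fC x Ox; have [fd fc] := fC x Ox.
have hdiff s : differentiable h s by apply/derivable1_diffP; have [] := hd s.
split; first exact: (differentiable_comp fd (hdiff _)).
move=> v.
have dE y : O y -> 'd (fun x => h (f x)) y v = dh (f y) * 'd f y v.
  move=> Oy; have [fdy _] := fC y Oy.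
  have [_ <-] := hd (f y); rewrite -derive1E mulrC.
  have E := congr1 (fun k : 'rV_n -> R => k v) (diff_comp fdy (hdiff (f y))).
  apply: (eq_trans E); exact: (congr1 (fun k : R -> R => k _) (diff1E (hdiff (f y)))).
have dhf : (fun y => dh (f y)) @ x --> dh (f x).
  by apply: continuous_comp; [exact: differentiable_continuous|exact: dhc].
have hc : {for x, continuous (fun y => dh (f y) * 'd f y v)}.
  exact: (cvgM dhf (fc v)).
apply: (open_eq_continuous_for oO Ox _ hc) => y Oy.
by apply: esym; exact: dE.
Qed.

End C1_calculus.

(** * A continuously differentiable bump function *)

(** Suited to [hinge], whose remainder is at most [h ^+ 2] at every point including 0, so that the
    two one-sided derivatives at 0 need not be matched. *)
Lemma is_derive_quadratic_remainder (R : realType) (f : R -> R) (s l : R) :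
  (forall h, `|f (h + s) - f s - l * h| <= h ^+ 2) -> is_derive s 1 f l.
Proof.
move=> fs; have dE : (fun h => h^-1 *: ((f \o shift s) (h *: 1) - f s)) @ 0^' --> l.
  apply/cvgrPdist_le => e e0; near=> h.
  have h0 : h != 0 by near: h; exact: nbhs_dnbhs_neq.
  rewrite /= [h *: 1]mulr1 -[_ *: _]/(_ * _).
  have -> : l - h^-1 * (f (h + s) - f s) = - (h^-1 * (f (h + s) - f s - l * h)).
    by field.
  rewrite normrN normrM normfV ler_pdivrMl ?normr_gt0//.
  apply: le_trans (fs h) _; rewrite -real_normK ?num_real// expr2.
  apply: ler_wpM2l => //; near: h; exact: dnbhs0_le.
by split; [apply/cvg_ex; exists l | apply/cvg_lim].
Unshelve. all: by end_near. Qed.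

(* The square makes the positive part continuously differentiable. *)
Definition hinge (R : realType) (s : R) : R := Num.max 0 s ^+ 2.

Lemma hinge_gt0 (R : realType) (s : R) : 0 < s -> 0 < hinge s.
Proof. by move=> s0; rewrite /hinge exprn_gt0// lt_max s0 orbT. Qed.

Lemma hinge_eq0 (R : realType) (s : R) : s <= 0 -> hinge s = 0.
Proof. by move=> s0; rewrite /hinge max_l// expr0n. Qed.

Lemma is_derive_hinge (R : realType) (s : R) :
  is_derive s 1 (@hinge R) (2 * Num.max 0 s).
Proof.
apply: is_derive_quadratic_remainder => h; rewrite /hinge ler_norml.
by have [h1|h1] := leP 0 (h + s); have [h2|h2] := leP 0 s;
  apply/andP; split; nra.
Qed.

Lemma continuous_dhinge (R : realType) : continuous (fun s : R => 2 * Num.max 0 s).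
Proof.
move=> s; apply: cvgM; first exact: cvg_cst.
by apply: continuous_max; [exact: cst_continuous|exact: cvg_id].
Qed.

Section bump.
Context {R : realType} {n : nat} (a : 'rV[R]_n) (r : R).

(** The norm on row vectors is the maximum norm, which is not differentiable; the squared Euclidean
    distance is a polynomial. *)
Definition sqdist (z : 'rV[R]_n) : R := \sum_i (z 0 i - a 0 i) ^+ 2.

Definition bump (z : 'rV[R]_n) : R := hinge (r - sqdist z).

Lemma C1_bump : C1_on setT bump.
Proof.
apply: (@C1_on_compR _ _ _ (fun z => r - sqdist z) (@hinge R)
  (fun s => 2 * Num.max 0 s)) => //.
- exact: openT.
- by move=> s; exact: is_derive_hinge.
- exact: continuous_dhinge.
have C i : C1_on setT (fun z : 'rV[R]_n => z 0 i - a 0 i).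
  exact: (C1_onD openT (@C1_coord R n setT i) (@C1_cst R n setT (- a 0 i))).
have := C1_onD openT (@C1_cst R n setT r) (C1_onM openT (@C1_cst R n setT (-1))
  (C1_on_sum openT (fun i => C1_onM openT (C i) (C i)))).
apply: C1_on_eq; first exact: openT.
move=> z _; rewrite mulN1r; congr (_ - _).
Qed.

Lemma bump_center : 0 < r -> 0 < bump a.
Proof.
move=> r0; apply: hinge_gt0; rewrite /sqdist big1 ?subr0// => i _.
by rewrite subrr expr0n.
Qed.

(** Some coordinate attains the maximum norm of [z - a], and its square alone already exceeds or
    equals [r], hence so does the sum of squares. *)
Lemma bump_eq0 z : Num.sqrt r <= `|z - a| -> bump z = 0.
Proof.
move=> rz; apply: hinge_eq0; rewrite subr_le0.
have [r0|r0] := leP r 0.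
  by apply: (le_trans r0); apply: sumr_ge0 => i _; exact: sqr_ge0.
have : 0 < `|z - a| by apply: lt_le_trans rz; rewrite sqrtr_gt0.
move=> /lt0r_neq0 /mx_norm_neq0[[j i] /= zi].
have {}zi : `|z - a| = `|z 0 i - a 0 i| by rewrite -[LHS]/(mx_norm (z - a)) zi ord1 !mxE.
rewrite /sqdist (bigD1 i)//=; apply: ler_wpDr.
  by apply: sumr_ge0 => k _; exact: sqr_ge0.
rewrite -(sqr_sqrtr (ltW r0)) -[leRHS]real_normK ?num_real//.
by rewrite -zi ler_sqr ?nnegrE ?sqrtr_ge0.
Qed.

End bump.

(** * Charts and curves *)

Section charts.
Context {R : realType} {n : nat}.

Lemma chart_image_nbhs (T : topologicalType) (d : chart R n T) (y : T) (W : set T) :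
  chart_dom d y -> nbhs y W -> nbhs (d y) (d @` (W `&` chart_dom d)).
Proof.
move=> dy Wy.
have iy : (d @` chart_dom d) (d y) by exists y.
have h1 := open_nbhs_nbhs (conj (@chart_img_open _ _ _ d) iy).
have h2 : nbhs (d y) (chart_inv d @^-1` W).
  by apply: (chart_inv_continuous iy); rewrite chart_funK.
apply: filterS (filterI h1 h2) => z [[u du <-]] /=.
by rewrite chart_funK// => Wu; exists u.
Qed.

Lemma chart_image_open (T : topologicalType) (d : chart R n T) (W : set T) :
  open W -> open (d @` (W `&` chart_dom d)).
Proof.
move=> oW; rewrite openE => _ [y [Wy dy] <-].
by apply: chart_image_nbhs => //; exact: open_nbhs_nbhs.
Qed.

Lemma chart_inv_image (T : topologicalType) (d : chart R n T) (W : set T) z :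
  (d @` (W `&` chart_dom d)) z ->
  [/\ W (chart_inv d z), chart_dom d (chart_inv d z) & d (chart_inv d z) = z].
Proof. by move=> [y [Wy dy] <-]; rewrite chart_funK. Qed.

Context (M : C1manifold R n).

Definition chart_extend (c : chart R n M) (g : 'rV[R]_n -> R) (y : M) : R :=
  if `[< chart_dom c y >] then g (c y) else 0.

Lemma chart_extendE (c : chart R n M) g y :
  chart_dom c y -> chart_extend c g y = g (c y).
Proof. by move=> cy; rewrite /chart_extend asboolT. Qed.

(** The closed ball is compact, so its preimage [K] in the manifold is compact, hence closed because
    the manifold is Hausdorff. The extension vanishes on the open set off [K], and on the domain of
    [c] it is [g] composed with a transition map; these two open sets cover the manifold. *)
Lemma C1_chart_extend (c : chart R n M) (a : 'rV[R]_n) (r : R) g : atlas c -> 0 < r ->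
  [set z | `|z - a| <= r] `<=` c @` chart_dom c ->
  C1_on setT g -> (forall z, r <= `|z - a| -> g z = 0) ->
  C1_function (chart_extend c g).
Proof.
move=> ac r0 sub gC g0 d ad.
pose K := chart_inv c @` [set z | `|z - a| <= r].
have cK : closed K.
  apply: compact_closed; first exact: mfd_hausdorff.
  apply: continuous_compact.
    apply: continuous_in_subspaceT => z /set_mem /sub; exact: chart_inv_continuous.
  apply: bounded_closed_compact.
    exists (`|a| + r); split; first exact: num_real.
    move=> s rs z /= zr; apply/ltW/le_lt_trans/rs.
    by rewrite -(subrK a z) addrC; apply: (le_trans (ler_normD _ _)); rewrite lerD2l.
  rewrite (_ : [set z | _] = closed_ball a r); first exact: closed_ball_closed.
  by rewrite closed_ballE//; apply/seteqP; split => z; rewrite /= /closed_ball_/= distrC.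
have oK : open (~` K) by exact: closed_openC.
have extK y : ~ K y -> chart_extend c g y = 0.
  move=> nKy; rewrite /chart_extend; case: asboolP => // cy.
  apply: g0; rewrite leNgt; apply/negP => h; apply: nKy.
  by exists (c y); [exact: ltW|rewrite chart_funK].
have C1a : C1_on (d @` (chart_dom c `&` chart_dom d)) (chart_extend c g \o chart_inv d).
  have od := @chart_image_open _ d _ (@chart_dom_open _ _ _ c).
  have tC : C1_on (d @` (chart_dom c `&` chart_dom d)) (c \o chart_inv d).
    by rewrite setIC; exact: atlas_C1.
  have := C1_on_comp od (fun x _ => I) tC gC.
  apply: C1_on_eq => // z /chart_inv_image[cz _ _] /=.
  by rewrite chart_extendE.
have C1b : C1_on (d @` (~` K `&` chart_dom d)) (chart_extend c g \o chart_inv d).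
  have oW := @chart_image_open _ d _ oK.
  apply: (C1_on_eq oW _ (@C1_cst R n (d @` (~` K `&` chart_dom d)) 0)).
  by move=> z /chart_inv_image[nK _ _] /=; rewrite extK.
move=> z [y dy <-]; have [Ky|nKy] := pselect (K y); last by apply: C1b; exists y.
apply: C1a; exists y => //; split => //.
by case: Ky => w /sub[u cu <-] <-; rewrite chart_funK.
Qed.

(* Near [x] the coordinates of [c] are the quotients [q i / p], whereas only
   globally defined functions may be composed with a curve. *)
Lemma chart_test_functions (c : chart R n M) (x : M) (U : set M) :
  atlas c -> chart_dom c x -> nbhs x U ->
  exists (p : M -> R) (q : 'I_n -> M -> R),
  [/\ C1_function p, forall i, C1_function (q i), 0 < p x,
      forall y, 0 < p y -> chart_dom c y /\ U y
    & forall y i, chart_dom c y -> q i y = p y * c y 0 i].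
Proof.
move=> ac cx Ux.
have /nbhs_ballP[e /= e0 Be] := chart_image_nbhs cx Ux.
have {}Be z : `|z - c x| < e -> (c @` (U `&` chart_dom c)) z.
  by move=> h; apply: Be; rewrite mx_norm_ball /ball_ /= distrC.
(* The closed ball supporting the bump must fit into the image of the chart, where only an open ball
   of radius [e] is known to lie. *)
pose r := e / 2; have r0 : 0 < r by rewrite divr_gt0.
have re : r < e by rewrite /r; lra.
have sub : [set z | `|z - c x| <= r] `<=` c @` chart_dom c.
  move=> z /= zr; have [|y [_ cy] <-] := Be z; first exact: le_lt_trans re.
  by exists y.
have b0 z : r <= `|z - c x| -> bump (c x) (r ^+ 2) z = 0.
  by move=> rz; apply: bump_eq0; rewrite sqrtr_sqr ger0_norm// ltW.
exists (chart_extend c (bump (c x) (r ^+ 2))),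
  (fun i => chart_extend c (fun z => bump (c x) (r ^+ 2) z * z 0 i)).
split.
- exact: (C1_chart_extend ac r0 sub (@C1_bump _ _ _ _) b0).
- move=> i; apply: (C1_chart_extend ac r0 sub) => [|z /b0 ->]; last by rewrite mul0r.
  exact: (C1_onM openT (@C1_bump _ _ _ _) (@C1_coord R n setT i)).
- by rewrite chart_extendE//; apply: bump_center; rewrite exprn_gt0.
- move=> y; rewrite /chart_extend; case: asboolP; last by rewrite ltxx.
  move=> cy h; split => //.
  have [/b0 b|/lt_trans/(_ re) yr] := leP r `|c y - c x|.
    by move: h; rewrite b ltxx.
  by have [u [Uu cu] E] := Be _ yr; rewrite -(chart_funK cy) -E chart_funK.
- by move=> y i cy; rewrite !chart_extendE.
Qed.

End charts.

(** * Variation over families of short disjoint intervals *)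

Section small_variation.
Context {R : realType}.

(** Absolute continuity of [f] is the case [w u v = |f v - f u|]. A general function [w] of the
    interval allows increments to be majorized by combinations of other increments. *)
Definition small_variation (a b : R) (w : R -> R -> R) : Prop :=
  forall e, 0 < e -> exists2 d, 0 < d &
    forall (m : nat) (u v : 'I_m -> R),
      (forall i, [/\ a <= u i, u i <= v i & v i <= b]) ->
      trivIset setT (fun i => `]u i, v i[%classic) ->
      \sum_(i < m) (v i - u i) < d -> \sum_(i < m) w (u i) (v i) < e.

Lemma small_variation0 a b : small_variation a b (fun _ _ => 0).
Proof. by move=> e e0; exists 1 => // m u v *; rewrite big1. Qed.

Lemma small_variationD a b w1 w2 : small_variation a b w1 ->
  small_variation a b w2 -> small_variation a b (fun u v => w1 u v + w2 u v).
Proof.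
move=> h1 h2 e e0; have e20 : 0 < e / 2 by rewrite divr_gt0.
have [d1 d10 {}h1] := h1 _ e20; have [d2 d20 {}h2] := h2 _ e20.
exists (Num.min d1 d2); first by rewrite lt_min d10.
move=> m u v uv tr; rewrite lt_min => /andP[/(h1 _ _ _ uv tr) ? /(h2 _ _ _ uv tr) ?].
by rewrite big_split/= (splitr e) ltrD.
Qed.

Lemma small_variation_sum a b (I : Type) (s : seq I) (w : I -> R -> R -> R) :
  (forall i, small_variation a b (w i)) ->
  small_variation a b (fun u v => \sum_(i <- s) w i u v).
Proof.
move=> h; elim: s => [|i s IH] e e0.
  have [d d0 hd] := small_variation0 a b e0.
  by exists d => // *; under eq_bigr do rewrite big_nil; exact: hd.
have [d d0 hd] := small_variationD (h i) IH e0.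
by exists d => // *; under eq_bigr do rewrite big_cons; exact: hd.
Qed.

Lemma small_variationZ a b k w : 0 <= k -> small_variation a b w ->
  small_variation a b (fun u v => k * w u v).
Proof.
move=> k0 h e e0; have k1 : 0 < k + 1 by lra.
have [d d0 hd] := h _ (divr_gt0 e0 k1).
exists d => // m u v uv tr sd; rewrite -mulr_sumr.
have := hd m u v uv tr sd; rewrite ltr_pdivlMr// mulrDr mulr1.
(* The values of [w] may be negative, so the sign of the sum decides how multiplication by [k]
   acts. *)
have [s0|s0] := leP 0 (\sum_(i < m) w (u i) (v i)); first by rewrite mulrC; lra.
by move=> _; apply: le_lt_trans e0; apply: mulr_ge0_le0 => //; exact: ltW.
Qed.

Lemma small_variation_le a b w1 w2 :
  (forall u v, a <= u -> u <= v -> v <= b -> w1 u v <= w2 u v) ->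
  small_variation a b w2 -> small_variation a b w1.
Proof.
move=> h12 h e e0; have [d d0 hd] := h e e0.
exists d => // m u v uv tr sd; apply: le_lt_trans (hd m u v uv tr sd).
by apply: ler_sum => i _; have [? ? ?] := uv i; exact: h12.
Qed.

End small_variation.

Lemma row_norm_le_sum (R : realType) n (z : 'rV[R]_n) : `|z| <= \sum_i `|z 0 i|.
Proof.
rewrite -[leLHS]/(mx_norm z) mx_normrE; apply: bigmax_le.
  by apply: sumr_ge0.
move=> [i j] _ /=; rewrite ord1 (bigD1 j)//= lerDl; exact: sumr_ge0.
Qed.

Lemma row_coord_le_norm (R : realType) n (z : 'rV[R]_n) i : `|z 0 i| <= `|z|.
Proof.
rewrite -[leRHS]/(mx_norm z) mx_normrE; exact: (le_bigmax _ _ (0, i)).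
Qed.

Lemma lipschitz_in (R : realType) (V W : normedModType R) (f : V -> W) (B : set V) :
  [lipschitz f y | y in B] ->
  exists2 k, 0 <= k & forall y z, B y -> B z -> `|f y - f z| <= k * `|y - z|.
Proof.
(* The Lipschitz bound holds for all constants beyond [k0]; this one is moreover nonnegative. *)
move=> [k0 [_ kB]]; exists (`|k0| + 1); first exact: addr_ge0.
move=> y z By Bz; apply: (kB (`|k0| + 1) _ (y, z)); last by split.
by apply: le_lt_trans (ler_norm _) _; rewrite ltrDl.
Qed.

Section curves.
Context {R : realType} {n : nat} (M : C1manifold R n).
Context (a b : R) (I : set R) (g : R -> M).
Hypothesis gac : loc_abs_continuous_curve I g.
Hypothesis ab : a <= b.
Hypothesis abI : `[a, b] `<=` I.

(** Continuity of the curve is tested by a single function [p], positive at [g t] and positive only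
    inside [U]: it stays positive along the curve for a short time. *)
Lemma curve_near t (U : set M) : a <= t <= b -> nbhs (g t) U ->
  exists2 d, 0 < d & forall s, a <= s <= b -> `|s - t| < d -> U (g s).
Proof.
move=> tab Ut.
have [p [q [pC _ px pU _]]] :=
  chart_test_functions (chart_at_atlas (chart_of (g t))) (chart_at_dom (chart_of (g t))) Ut.
have [d d0 hd] := abs_continuous_dist (gac pC ab abI) px.
exists d => // s sab /(hd _ _ sab tab); rewrite ltr_norml/= => /andP[h _].
by have [|] := pU (g s); first lra.
Qed.

(** Where [p >= m > 0] and the coordinate is bounded by [B], an increment of the quotient [q i / p]
    is at most [m^-1] times the increment of [q i] plus [B] times that of [p]. *)
Lemma chart_coord_loc_abs_continuous (c : chart R n M) t : atlas c ->
  a <= t <= b -> chart_dom c (g t) ->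
  exists2 d, 0 < d & forall u v, a <= u -> v <= b -> t - d < u -> v < t + d ->
    forall i, abs_continuous u v (fun s => c (g s) 0 i).
Proof.
move=> ac tab ct.
have cn : nbhs (g t) [set y | `|c y - c (g t)| < 1].
  have h : nbhs (g t) (c @^-1` ball (c (g t)) 1).
    exact: chart_fun_continuous ct _ (nbhsx_ballx (c (g t)) _ ltr01).
  by apply: filterS h => y /=; rewrite mx_norm_ball /ball_/= distrC.
have [p [q [pC qC px pU qp]]] := chart_test_functions ac ct cn.
have p2 : 0 < p (g t) / 2 by rewrite divr_gt0.
have [d d0 hd] := abs_continuous_dist (gac pC ab abI) p2.
exists d => // u v au vb tu vt i.
set m := p (g t) / 2 in p2 hd.
have pm s : u <= s <= v -> m < p (g s).
  move=> /andP[us sv]; have := hd s t; rewrite !ltr_norml/= => /(_ _ tab).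
  have sab : a <= s <= b by apply/andP; split; lra.
  move=> /(_ sab); have -> : - d < s - t < d by apply/andP; split; lra.
  by move=> /(_ isT) /andP[+ _]; rewrite /m; lra.
(* [p] is positive only at points whose coordinates are within 1 of those of [g t]. *)
pose B := `|c (g t)| + 1.
have cB s : u <= s <= v -> chart_dom c (g s) /\ `|c (g s) 0 i| <= B.
  move=> /pm ms; have [cs us] := pU (g s) (lt_trans p2 ms); split => //.
  apply: le_trans (row_coord_le_norm _ _) _.
  rewrite -(subrK (c (g t)) (c (g s))) addrC; apply: le_trans (ler_normD _ _) _.
  by rewrite lerD2l ltW.
have B0 : 0 <= B by rewrite addr_ge0.
have S1 : small_variation u v (fun x y => m^-1 *
    (`|q i (g y) - q i (g x)| + B * `|p (g y) - p (g x)|)).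
  apply: small_variationZ; first by rewrite invr_ge0 ltW.
  apply: small_variationD; first exact: (abs_continuousS au vb (gac (qC i) ab abI)).
  by apply: small_variationZ => //; exact: (abs_continuousS au vb (gac pC ab abI)).
apply: (@small_variation_le _ u v (fun x y => `|c (g y) 0 i - c (g x) 0 i|) _ _ S1).
move=> x y ux xy yv.
have xI : u <= x <= v by apply/andP; split; lra.
have yI : u <= y <= v by apply/andP; split; lra.
have [cx Bx] := cB x xI; have [cy By] := cB y yI.
have [mx my] := (pm x xI, pm y yI).
rewrite ler_pdivlMl// !qp//.
have -> : p (g y) * c (g y) 0 i - p (g x) * c (g x) 0 i =
  p (g y) * (c (g y) 0 i - c (g x) 0 i) + c (g x) 0 i * (p (g y) - p (g x)) by ring.
set A1 := c (g y) 0 i - _; set C := c (g x) 0 i in Bx *; set P1 := _ - p (g x).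
have h1 : p (g y) * `|A1| <= `|p (g y) * A1 + C * P1| + `|C * P1|.
  have -> : p (g y) * `|A1| = `|p (g y) * A1|.
    by rewrite normrM (ger0_norm (ltW (lt_trans p2 my))).
  by rewrite -[in leLHS](addrK (C * P1) (p (g y) * A1)); apply: ler_normB.
have h2 : `|C * P1| <= B * `|P1| by rewrite normrM; apply: ler_wpM2r.
have h3 : m * `|A1| <= p (g y) * `|A1| by apply: ler_wpM2r => //; exact: ltW.
lra.
Qed.

Lemma lipschitz_comp_loc_abs_continuous (V : M -> R) t : locally_lipschitz_on setT V ->
  a <= t <= b -> loc_abs_continuous_at a b (V \o g) t.
Proof.
move=> Vl tab; have [c [B Bn lip]] := Vl (g t) Logic.I.
have [k k0 kB] := lipschitz_in lip.
have Un : nbhs (g t) (chart_dom c `&` c @^-1` B).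
  apply: filterI; last exact: (chart_fun_continuous (chart_at_dom c)).
  by apply: open_nbhs_nbhs; split; [exact: chart_dom_open|exact: chart_at_dom].
have [d1 d10 hd1] := curve_near tab Un.
have [d2 d20 hd2] := chart_coord_loc_abs_continuous (chart_at_atlas c) tab (chart_at_dom c).
exists (Num.min d1 d2); first by rewrite lt_min d10.
move=> u v au vb; rewrite ltrBlDr -ltrBlDl lt_min => /andP[tu1 tu2] ut tv.
rewrite -ltrBlDl lt_min => /andP[vt1 vt2].
have S1 : small_variation u v (fun x y => k * \sum_i `|c (g y) 0 i - c (g x) 0 i|).
  apply: small_variationZ => //; apply: small_variation_sum => i.
  by apply: hd2; lra.
apply: (@small_variation_le _ u v (fun x y => `|V (g y) - V (g x)|) _ _ S1).
move=> x y ux xy yv.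
have near s : u <= s <= v -> chart_dom c (g s) /\ B (c (g s)).
  move=> /andP[us sv]; apply: hd1; first by apply/andP; split; lra.
  by rewrite ltr_norml; apply/andP; split; lra.
have [|cx Bx] := near x; first by apply/andP; split; lra.
have [|cy By] := near y; first by apply/andP; split; lra.
rewrite /= -{1}(chart_funK cx) -{1}(chart_funK cy).
apply: le_trans (kB _ _ By Bx) _; apply: ler_wpM2l => //.
apply: le_trans (row_norm_le_sum _) _; apply: ler_sum => i _.
by rewrite !mxE.
Qed.

End curves.

(** * Clarke derivatives along curves *)

Lemma row_norm_le (R : realType) n (z : 'rV[R]_n) (k : R) :
  0 <= k -> (forall i, `|z 0 i| <= k) -> `|z| <= k.
Proof.
move=> k0 zk; rewrite -[leLHS]/(mx_norm z) mx_normrE; apply: bigmax_le => //.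
by move=> [i j] _; rewrite ord1; exact: zk.
Qed.

Section local_lipschitz.
Context {R : realType} {n m : nat}.

Lemma is_derive_line (f : 'rV[R]_n -> 'rV[R]_m) (y v : 'rV[R]_n) (s : R) j :
  differentiable f (s *: v + y) ->
  is_derive s 1 (fun r => f (r *: v + y) 0 j : R) ('d f (s *: v + y) v 0 j).
Proof.
move=> fd; set p := s *: v + y in fd *.
have h := @diff_derivable _ _ _ f p v fd.
have E : (fun h => h^-1 *: (((fun r : R => f (r *: v + y) 0 j : R) \o shift s) (h *: 1)
     - f (s *: v + y) 0 j)) =
  (fun h => h^-1 *: (((fun x => f x 0 j : R) \o shift p) (h *: v) - f p 0 j)).
  apply/funext => r /=; congr (_ *: (f _ 0 j - _)).
  by rewrite /p [r *: 1]mulr1 scalerDl addrA.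
have hj := (derivable_mxP f p v).1 h 0 j.
split; first by rewrite /derivable E.
by rewrite -deriveE// derive_mx// mxE /derive E.
Qed.

(** Near [x] each partial derivative has norm at most [B i], its norm at [x] plus 1. The mean value
    theorem, applied to each coordinate of [f] on the segment from [z] to [y], gives the Lipschitz
    constant [\sum_i B i]. *)
Lemma C1_on_lipschitz (O : set 'rV[R]_n) (f : 'rV[R]_n -> 'rV[R]_m) x :
  open O -> O x -> C1_on O f ->
  exists k r, [/\ 0 <= k, 0 < r & forall y z, `|y - x| < r -> `|z - x| < r ->
    `|f y - f z| <= k * `|y - z|].
Proof.
move=> oO Ox fC.
pose B i := `|'d f x (delta_mx 0 i)| + 1.
have near_x : nbhs x [set y | O y /\ forall i : 'I_n, `|'d f y (delta_mx 0 i)| <= B i].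
  have nearB i : nbhs x [set y | `|'d f y (delta_mx 0 i)| <= B i].
    have [_ /(_ (delta_mx 0 i)) fi] := fC x Ox.
    have h : nbhs x
        ((fun y => 'd f y (delta_mx 0 i)) @^-1` ball ('d f x (delta_mx 0 i)) 1).
      exact: fi _ (nbhsx_ballx _ _ ltr01).
    apply: filterS h => y /=; rewrite mx_norm_ball /ball_/= => h.
    rewrite /B addrC -lerBlDr; apply: le_trans (ltW h).
    by rewrite distrC; exact: lerB_dist.
  apply: (@filterI _ (nbhs x) (nbhs_filter x)).
    exact: open_nbhs_nbhs.
  exact: (@filter_forall _ _ (fun i => [set y | `|'d f y (delta_mx 0 i)| <= B i])
      (nbhs x) (nbhs_filter x) nearB).
have /nbhs_ballP[r /= r0 xr] := near_x.
have {}xr y : `|y - x| < r -> O y /\ forall i : 'I_n, `|'d f y (delta_mx 0 i)| <= B i.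
  by move=> yr; apply: xr; rewrite mx_norm_ball /ball_/= distrC.
have B0 i : 0 <= B i by rewrite addr_ge0.
exists (\sum_i B i), r; split => //; first exact: sumr_ge0.
move=> y z yr zr; apply: row_norm_le.
  by rewrite mulr_ge0// sumr_ge0.
move=> j; set v := y - z.
have seg s : s \in `[0, 1] -> `|s *: v + z - x| < r.
  rewrite in_itv/= => /andP[s0 s1].
  have -> : s *: v + z - x = s *: (y - x) + (1 - s) *: (z - x).
    by apply/rowP => k; rewrite !mxE; ring.
  apply: le_lt_trans (ler_normD _ _) _; rewrite !normrZ !ger0_norm ?subr_ge0//.
  have [->|sn0] := eqVneq s 0; first by rewrite mul0r add0r subr0 mul1r.
  have {sn0}s0 : 0 < s by rewrite lt_neqAle eq_sym sn0.
  by nra.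
have [||s s01] := @MVT_segment _ (fun s => f (s *: v + z) 0 j : R)
  (fun s => 'd f (s *: v + z) v 0 j) 0 1 ler01.
- move=> s s01; apply: is_derive_line.
  have [] := fC (s *: v + z) => //; apply: (xr _ _).1; apply: seg.
  exact: subset_itv_oo_cc s01.
- apply: continuous_in_subspaceT => s /set_mem/= s01.
  have [D _] : is_derive s 1 (fun s => f (s *: v + z) 0 j : R) ('d f (s *: v + z) v 0 j).
    apply: is_derive_line.
    by have [] := fC (s *: v + z) => //; apply: (xr _ _).1; exact: seg.
  exact/differentiable_continuous/derivable1_diffP.
rewrite scale1r scale0r add0r subr0 mulr1 /v subrK => E.
have -> : (f y - f z) 0 j = f y 0 j - f z 0 j by rewrite !mxE.
rewrite E; apply: le_trans (row_coord_le_norm _ _) _.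
have [_ dB] := xr _ (seg s s01).
rewrite diff_row_sum; apply: le_trans (ler_norm_sum _ _ _) _.
rewrite mulr_suml; apply: ler_sum => i _; rewrite normrZ mulrC.
by apply: ler_pM => //; exact: row_coord_le_norm.
Qed.

End local_lipschitz.

Section clarke.
Context {R : realType} {n : nat} (M : C1manifold R n) (V : M -> R).
Hypothesis Vlip : locally_lipschitz_on setT V.

(** The hypothesis provides some chart, whereas Clarke's derivative is computed in a chosen one. The
    transition map between them is locally Lipschitz, being continuously differentiable. *)
Lemma locally_lipschitz_chart x (c : chart_at x) :
  exists k r, [/\ 0 <= k, 0 < r & forall y z, `|y - c x| < r -> `|z - c x| < r ->
    `|V (chart_inv c y) - V (chart_inv c z)| <= k * `|y - z|].
Proof.
have [c' [B Bn /lipschitz_in[k k0 kB]]] := Vlip (x := x) I.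
pose O := c @` (chart_dom c `&` chart_dom c').
have oO : open O.
  by rewrite /O setIC; apply: chart_image_open; exact: chart_dom_open.
have Ox : O (c x) by exists x => //; split; exact: chart_at_dom.
have C1T := atlas_C1 (chart_at_atlas c) (chart_at_atlas c').
have [l [r [l0 r0 lip]]] := C1_on_lipschitz oO Ox C1T.
have Tx : chart_inv c (c x) = x by rewrite chart_funK//; exact: chart_at_dom.
have near_x : nbhs (c x) [set y | O y /\ B (c' (chart_inv c y))].
  apply: (@filterI _ (nbhs (c x)) (nbhs_filter _)); first exact: open_nbhs_nbhs.
  have [D _] := C1T _ Ox; apply: (differentiable_continuous D).
  by rewrite /= Tx.
have /nbhs_ballP[r' /= r'0 xr] := near_x.
have {}xr y : `|y - c x| < r' -> O y /\ B (c' (chart_inv c y)).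
  by move=> yr; apply: xr; rewrite mx_norm_ball /ball_/= distrC.
have VE y : O y -> V (chart_inv c y) = V (chart_inv c' (c' (chart_inv c y))).
  by move=> [u [cu c'u] <-]; rewrite (chart_funK cu) (chart_funK c'u).
exists (k * l), (Num.min r r'); split; [exact: mulr_ge0|by rewrite lt_min r0|].
move=> y z; rewrite !lt_min => /andP[yr /xr[Oy By]] /andP[zr /xr[Oz Bz]].
rewrite VE// [V (chart_inv c z)]VE//; apply: le_trans (kB _ _ By Bz) _.
by rewrite -mulrA; apply: ler_wpM2l => //; exact: lip.
Qed.

(** The limsup is an infimum of suprema over members of the filter, so one member already has its
    supremum below [l + e]; it contains a ball times a right neighbourhood of 0. *)
Lemma clarke_deriv_le x (v : tangent x) (l e : R) : (clarke_deriv V v <= l%:E)%E ->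
  0 < e -> let c := chart_of x in exists2 r, 0 < r & forall y t, `|y - c x| < r ->
    0 < t < r ->
    V (chart_inv c (y + t *: tcoord v c)) - V (chart_inv c y) <= (l + e) * t.
Proof.
move=> vl e0 c; have : (clarke_deriv V v < (l + e)%:E)%E.
  by apply: le_lt_trans vl _; rewrite lte_fin ltrDl.
move=> /ereal_inf_lt[_ [A FA <-] sA].
have [[A1 A2] /= [/nbhs_ballP[r1 /= r10 A1r] [r2 /= r20 A2r]] AA] := FA.
exists (Num.min r1 r2); first by rewrite lt_min r10.
move=> y t; rewrite !lt_min => /andP[yr1 _] /andP[t0 /andP[_ tr2]].
have At : A (y, t).
  apply: AA; split => /=; first by apply: A1r; rewrite mx_norm_ball /ball_/= distrC.
  by apply: A2r => //=; rewrite distrC subr0 gtr0_norm.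
rewrite -ler_pdivrMr// -lee_fin; apply: le_trans (ltW sA).
by apply: ereal_sup_ubound; exists (y, t).
Qed.

Lemma is_derive_near (W : normedModType R) (p : R -> W) (t : R) (w : W) (e : R) :
  is_derive t 1 p w -> 0 < e ->
  exists2 d, 0 < d & forall s, `|s - t| < d ->
    `|p s - p t - (s - t) *: w| <= e * `|s - t|.
Proof.
move=> [pd pw] e0; have D := (derivable1_diffP p t).1 pd.
have [d /= d0 hd] := differentiable_near_norm D e0.
exists d => // s st; have := hd (s - t); rewrite /= sub0r normrN => /(_ st).
by rewrite subrK diff1E//= derive1E pw.
Qed.

(** The first-order expansion at [t] is used at both ends. As [t] lies between [u] and [s], the
    errors [e * (t - u)] and [e * (s - t)] add up to [e * (s - u)], which makes the increment from
    [u] to [s] follow [w] too. The other bounds keep all points involved close to [p t]. *)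
Lemma row_increment_le m (p : R -> 'rV[R]_m) (t : R) (w : 'rV[R]_m) (e d u s : R) : 0 <= e ->
  (forall s, `|s - t| < d -> `|p s - p t - (s - t) *: w| <= e * `|s - t|) ->
  t - d < u -> u <= t -> t <= s -> s < t + d ->
  let K := (e + 2 * `|w|) * (s - u) in
  [/\ `|p s - (p u + (s - u) *: w)| <= e * (s - u), `|p u - p t| <= K,
      `|p s - p t| <= K & `|p u + (s - u) *: w - p t| <= K].
Proof.
move=> e0 hp tu ut ts st K.
have tu0 : 0 <= t - u by rewrite subr_ge0.
have st0 : 0 <= s - t by rewrite subr_ge0.
have us0 : 0 <= s - u by lra.
have nut : `|u - t| = t - u by rewrite distrC ger0_norm.
have pu : `|p u - p t - (u - t) *: w| <= e * (t - u).
  by rewrite -nut; apply: hp; rewrite nut; lra.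
have ps : `|p s - p t - (s - t) *: w| <= e * (s - t).
  by rewrite -{2}(ger0_norm st0); apply: hp; rewrite ger0_norm; lra.
have w0 := normr_ge0 w.
have e1 : 0 <= e * (t - u) by exact: mulr_ge0.
have e2 : 0 <= e * (s - t) by exact: mulr_ge0.
have w1 : 0 <= `|w| * (t - u) by exact: mulr_ge0.
have w2 : 0 <= `|w| * (s - t) by exact: mulr_ge0.
have du : `|p u - p t| <= (e + `|w|) * (t - u).
  rewrite -(subrK ((u - t) *: w) (p u - p t)); apply: le_trans (ler_normD _ _) _.
  by rewrite normrZ nut; clear - pu; lra.
have ds : `|p s - p t| <= (e + `|w|) * (s - t).
  rewrite -(subrK ((s - t) *: w) (p s - p t)); apply: le_trans (ler_normD _ _) _.
  by rewrite normrZ (ger0_norm st0); clear - ps; lra.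
split.
- have -> : p s - (p u + (s - u) *: w) =
      (p s - p t - (s - t) *: w) - (p u - p t - (u - t) *: w).
    by clear; apply/rowP => i; rewrite !mxE; ring.
  by apply: le_trans (ler_normB _ _) _; clear - pu ps; lra.
- by rewrite /K; clear - du e1 e2 w1 w2; lra.
- by rewrite /K; clear - ds e1 e2 w1 w2; lra.
- rewrite addrAC; apply: le_trans (ler_normD _ _) _.
  by rewrite normrZ (ger0_norm us0) /K; clear - du e1 e2 w1 w2; lra.
Qed.

(** The step from [p u] to [p s] passes through [p u + tau *: w]. Clarke's bound at the base point
    [p u] controls the first part, and the Lipschitz constant times the first-order error controls
    the second; each costs [e / 2]. *)
Lemma clarke_upper_rate (a b : R) (J : set R) (g : R -> M) t (v : tangent (g t)) l :
  loc_abs_continuous_curve J g -> `[a, b] `<=` J -> a <= t <= b ->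
  has_velocity g t v -> (clarke_deriv V v <= l%:E)%E ->
  upper_rate a b (V \o g) t l.
Proof.
move=> gac abJ tab gv vl e e0.
have ab : a <= b by move: tab => /andP[]; exact: le_trans.
set c := chart_of (g t); set w := tcoord v c.
have [k [r [k0 r0 lip]]] := locally_lipschitz_chart c.
have e1 : 0 < e / 2 by rewrite divr_gt0.
have [r1 r10 hr1] := clarke_deriv_le vl e1.
have k10 : 0 < k + 1 by exact: ltr_wpDl.
pose e2 := e / 2 / (k + 1); have e20 : 0 < e2 by rewrite divr_gt0.
have ke : k * e2 <= e / 2.
  rewrite /e2 mulrCA ler_piMr ?(ltW e1)// ler_pdivrMr// mul1r lerDl.
  exact: ler01.
have [d1 d10 hd1] := is_derive_near (gv c) e20.
have cn : nbhs (g t) (chart_dom c).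
  by apply: open_nbhs_nbhs; split; [exact: chart_dom_open|exact: chart_at_dom].
have [d2 d20 hd2] := curve_near gac ab abJ tab cn.
(* The [+ 1] gives [1 <= K], so that [K * tau < rho] bounds [tau] itself as well as the
   displacements. *)
pose K := e2 + 2 * `|w| + 1.
have [K0 K1] : 0 < K /\ 1 <= K.
  have w0 := normr_ge0 w; rewrite /K; clear - w0 e20.
  by split; lra.
pose rho := Num.min r r1; have rho0 : 0 < rho by rewrite lt_min r0.
have [rho_r rho_r1] : rho <= r /\ rho <= r1 by rewrite !ge_min !lexx orbT.
(* Both [t - u] and [s - t] are below [d3], hence [K * tau < K * (2 * d3) = rho]. *)
pose d3 := rho / (2 * K).
have d30 : 0 < d3 by rewrite divr_gt0// mulr_gt0.
have Kd3 : K * (2 * d3) = rho by clear - K0; rewrite /d3; field; rewrite gt_eqF.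
exists (Num.min d1 (Num.min d2 d3)); first by rewrite !lt_min d10 d20.
move=> u s au sb.
rewrite ltrBlDr -ltrBlDl !lt_min => /and3P[tu1 tu2 tu3] ut ts.
rewrite -ltrBlDl !lt_min => /and3P[st1 st2 st3].
have [us|us] := leP s u.
  have -> : s = u by apply/eqP; rewrite eq_le us (le_trans ut ts).
  by rewrite !subrr mulr0.
set p : R -> 'rV[R]_n := c \o g.
have [|||||inc du ds dz] := @row_increment_le n p t w e2 d1 u s _ hd1 => //.
- exact: ltW.
- by clear - tu1; lra.
- by clear - st1; lra.
set tau := s - u in inc du ds dz *.
have tau0 : 0 < tau by rewrite subr_gt0.
have Ktau : K * tau < rho.
  by rewrite -Kd3 ltr_pM2l// /tau; clear - tu3 st3; lra.
have lt_rho x : x <= (e2 + 2 * `|w|) * tau -> x < rho.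
  move=> h; apply: le_lt_trans Ktau; apply: (le_trans h).
  by rewrite ler_pM2r// lerDl.
have gu : chart_inv c (p u) = g u.
  rewrite /p/= chart_funK//; apply: hd2; first by rewrite au (le_trans ut)// (le_trans ts).
  by rewrite ltr_norml; apply/andP; split; clear - tu2 ut d20; lra.
have gs : chart_inv c (p s) = g s.
  rewrite /p/= chart_funK//; apply: hd2; first by rewrite sb (le_trans au)// (le_trans ut).
  by rewrite ltr_norml; apply/andP; split; clear - st2 ts d20; lra.
have step1 : V (chart_inv c (p u + tau *: w)) - V (chart_inv c (p u)) <=
    (l + e / 2) * tau.
  apply: hr1; first exact: lt_le_trans (lt_rho _ du) rho_r1.
  rewrite tau0/=; apply: lt_le_trans rho_r1; apply: le_lt_trans Ktau.
  by rewrite ler_peMl// ltW.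
have step2 : V (chart_inv c (p s)) - V (chart_inv c (p u + tau *: w)) <=
    k * (e2 * tau).
  apply: le_trans (ler_norm _) _; apply: le_trans (lip _ _ _ _) _.
  - exact: lt_le_trans (lt_rho _ ds) rho_r.
  - exact: lt_le_trans (lt_rho _ dz) rho_r.
  - exact: ler_wpM2l.
have ketau : k * (e2 * tau) <= e / 2 * tau by rewrite mulrA ler_pM2r.
rewrite gs in step2; rewrite gu in step1; rewrite -[_ s]/(V (g s)) -[_ u]/(V (g u)).
by move: step1 step2 ketau; clear; lra.
Qed.

End clarke.

(** * Hybrid solutions *)

(** The points of the curve at times [t + tau i], with [tau i] decreasing to 0, lie in [C], and
    their difference quotients tend to the velocity. *)
Lemma velocity_tangent_cone (R : realType) n (M : C1manifold R n) (a b : R)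
    (J : set R) (g : R -> M) t (v : tangent (g t)) (C : set M) :
  loc_abs_continuous_curve J g -> `[a, b] `<=` J -> a < t < b ->
  (forall s, a < s < b -> C (g s)) -> has_velocity g t v ->
  tangent_cone_mfd C (g t) v.
Proof.
move=> gac abJ /andP[at_ tb] gC gv.
rewrite /tangent_cone_mfd /=; set c := chart_of (g t); set w := tcoord v c.
have cn : nbhs (g t) (chart_dom c).
  by apply: open_nbhs_nbhs; split; [exact: chart_dom_open|exact: chart_at_dom].
have ab : a <= b by lra.
have tab : a <= t <= b by apply/andP; split; lra.
have [d d0 hd] := curve_near gac ab abJ tab cn.
(* Keeps the times [t + tau i] before [b] and the points in the domain of the chart. *)
pose del := Num.min d (b - t) / 2.
have m0 : 0 < Num.min d (b - t) by rewrite lt_min d0; lra.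
have [m1 m2] : Num.min d (b - t) <= d /\ Num.min d (b - t) <= b - t.
  by rewrite !ge_min !lexx orbT.
have del0 : 0 < del by rewrite divr_gt0.
pose tau (i : nat) : R := del * harmonic i.
have tau0 i : 0 < tau i by rewrite mulr_gt0// invr_gt0.
have taudel i : tau i <= del.
  by rewrite /tau ler_piMr ?(ltW del0)// invf_le1 ?ltr0n// ler1n.
have tauc : tau @ \oo --> (0 : R).
  by rewrite -(mulr0 del); apply: cvgM; [exact: cvg_cst|exact: cvg_harmonic].
have near_tau e : 0 < e -> \forall i \near \oo, tau i < e.
  move=> e0; have /cvgrPdist_lt/(_ e e0) := tauc; apply: filterS => i.
  by rewrite sub0r normrN gtr0_norm.
have pd e : 0 < e -> exists2 d, 0 < d & forall s, `|s - t| < d ->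
    `|c (g s) - c (g t) - (s - t) *: w| <= e * `|s - t|.
  by move=> e0; exact: is_derive_near (gv c) e0.
exists (fun i => c (g (t + tau i))), tau; split => //.
- move=> i; have := tau0 i; have := taudel i; rewrite /del => ? ?.
  exists (g (t + tau i)) => //; split; first by apply: gC; apply/andP; split; lra.
  apply: hd; first by apply/andP; split; lra.
  by rewrite addrC addKr gtr0_norm//; lra.
- apply/cvgrPdist_le => e e0.
  have [d' d'0 hd'] := pd 1 ltr01.
  have w1 : 0 < `|w| + 1 by apply: ltr_wpDl.
  have ew : 0 < Num.min d' (e / (`|w| + 1)) by rewrite lt_min d'0 divr_gt0.
  apply: filterS (near_tau _ ew) => i; rewrite lt_min => /andP[h1 h2].
  have := hd' (t + tau i); rewrite addrC addKr gtr0_norm// => /(_ h1) h.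
  rewrite distrC -(subrK (tau i *: w) (_ - _)); apply: le_trans (ler_normD _ _) _.
  rewrite normrZ gtr0_norm//; move: h2; rewrite ltr_pdivlMr//; lra.
- apply/cvgrPdist_le => e e0; have [d' d'0 hd'] := pd e e0.
  apply: filterS (near_tau _ d'0) => i h1.
  have := hd' (t + tau i); rewrite addrC addKr gtr0_norm// => /(_ h1) h.
  have tn := lt0r_neq0 (tau0 i).
  have -> : w - (tau i)^-1 *: (c (g (t + tau i)) - c (g t)) =
      - ((tau i)^-1 *: (c (g (t + tau i)) - c (g t) - tau i *: w)).
    by rewrite [in RHS]scalerBr scalerA mulVf// scale1r opprB.
  by rewrite normrN normrZ normfV gtr0_norm// mulrC ler_pdivrMr.
Qed.

Section hybrid.
Context {R : realType} {n : nat} (M : C1manifold R n) (H : hybrid_system M).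
Implicit Types (phi : hybrid_arc M) (Q : R -> nat -> Prop).

(** The point lies in one of the compact hybrid time domains. Induction on the index of its
    switching times, one flow and one jump at a time, reaches [(tt j, j)], and a last flow reaches
    [(t, j)]. *)
Lemma arc_dom_ind phi Q : Q 0 0%N ->
  (forall s t j, 0 <= s -> s <= t -> `[s, t] `<=` time_slice (arc_dom phi) j ->
    Q s j -> Q t j) ->
  (forall t j, 0 <= t -> arc_dom phi (t, j) -> arc_dom phi (t, j.+1) ->
    Q t j -> Q t j.+1) ->
  forall t j, arc_dom phi (t, j) -> 0 <= t /\ Q t j.
Proof.
move=> Q0 Qf Qj t j; have [Es EsP dE] := arc_domP phi; rewrite dE => -[i _ Eij].
have [[J [tt [tt0 ttm EE]]] _] := EsP i.
have sub s k : (k <= J)%N -> tt k <= s <= tt k.+1 -> (\bigcup_i Es i) (s, k).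
  by move=> kJ sk; exists i => //; rewrite EE.
move: Eij; rewrite EE => -[/= jJ /andP[tj jt]].
have seg s s' k : (k <= J)%N -> tt k <= s -> s' <= tt k.+1 ->
    `[s, s'] `<=` time_slice (arc_dom phi) k.
  move=> kJ ks sk r /=; rewrite in_itv/= => /andP[sr rs].
  by rewrite /time_slice /= dE; apply: sub => //; apply/andP; split; lra.
have Qtt k : (k <= J)%N -> 0 <= tt k /\ Q (tt k) k.
  elim: k => [|k IH] kJ; first by rewrite tt0.
  have [tk Qk] := IH (ltnW kJ).
  have mk := ttm k (ltnW kJ); have mk1 := ttm k.+1 kJ.
  split; first exact: le_trans mk.
  apply: Qj; first exact: le_trans mk.
  - by rewrite dE; apply: sub; [exact: ltnW|rewrite mk lexx].
  - by rewrite dE; apply: sub => //; rewrite mk1 lexx.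
  - by apply: Qf Qk => //; apply: seg => //; exact: ltnW.
have [tj0 Qtj] := Qtt j jJ.
split; first exact: le_trans tj.
by apply: Qf Qtj => //; exact: seg.
Qed.

Lemma solution_time_ge0 phi t j : arc_dom phi (t, j) -> 0 <= t.
Proof.
move=> dtj; by have [] := @arc_dom_ind phi (fun _ _ => True) I
  (fun _ _ _ _ _ _ => id) (fun _ _ _ _ _ => id) _ _ dtj.
Qed.

End hybrid.

Section solutions.
Context {R : realType} {n : nat} (M : C1manifold R n) (H : hybrid_system M).
Context (V : M -> R).
Hypothesis Vlip : locally_lipschitz_on setT V.

Lemma jump_diff_le x y (r : R) : jump_map H x y ->
  (jump_diff H V x <= r%:E)%E -> V y <= V x + r.
Proof.
move=> xy; rewrite /jump_diff leeBlDr// => h.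
rewrite -lee_fin EFinD addeC; apply: le_trans h.
by apply: ereal_sup_ubound; exists y.
Qed.

Context (phi : hybrid_arc M).
Hypothesis phi_sol : is_solution H phi.

Lemma time_slice_interior (a b t : R) j :
  `[a, b] `<=` time_slice (arc_dom phi) j -> a < t < b ->
  (time_slice (arc_dom phi) j)° t.
Proof.
move=> sub /andP[at_ tb]; have : nbhs t `]a, b[%classic.
  by apply: near_in_itvoo; rewrite in_itv/= at_.
by apply: filterS => s /subset_itv_oo_cc; exact: sub.
Qed.

Lemma solution_flow_set (a b t : R) j :
  `[a, b] `<=` time_slice (arc_dom phi) j -> a < t < b -> flow_set H (phi t j).
Proof.
move=> sub tab; have it := time_slice_interior sub tab.
exact: (sol_flow_set phi_sol (ex_intro _ t it) it).
Qed.

Lemma solution_ae_upper_rate (a b : R) j (L : R -> R) :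
  `[a, b] `<=` time_slice (arc_dom phi) j ->
  (forall t, a < t < b -> (flow_deriv H V (phi t j) <= (L t)%:E)%E) ->
  {ae lebesgue_measure, forall t, a < t < b ->
    upper_rate a b (V \o phi ^~ j) t (L t)}.
Proof.
move=> sub VL.
have [ab|ab] := leP b a.
  apply: (@ae_lebesgueS _ (fun=> True)) => [t _ /andP[at_ tb]|]; first by lra.
  exact: (@nearW _ (almost_everywhere _)).
(* The differential inclusion is imposed only on slices with nonempty interior; the midpoint is an
   interior point. *)
have mid : a < (a + b) / 2 < b by apply/andP; split; lra.
have ne : (time_slice (arc_dom phi) j)° !=set0.
  by exists ((a + b) / 2); exact: time_slice_interior mid.
apply: ae_lebesgueS (sol_flow_map phi_sol ne) => t ht tab.
have [|v Fv vt] := ht; first by apply: sub; exact: subset_itv_oo_cc.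
have tab' : a <= t <= b by move: tab => /andP[? ?]; apply/andP; split; lra.
apply: (clarke_upper_rate Vlip (@arc_abs_continuous _ _ _ phi j) sub tab' vt).
apply: le_trans (VL t tab); apply: ereal_sup_ubound; exists v => //; split => //.
apply: (velocity_tangent_cone (@arc_abs_continuous _ _ _ phi j) sub tab) => //.
by move=> s; exact: solution_flow_set.
Qed.

Lemma solution_flow_le (a b : R) j (c : R) : a <= b ->
  `[a, b] `<=` time_slice (arc_dom phi) j ->
  (forall t, a < t < b -> (flow_deriv H V (phi t j) <= c%:E)%E) ->
  V (phi b j) - V (phi a j) <= c * (b - a).
Proof.
move=> ab sub Vc; apply: (ae_upper_rate_le (f := V \o phi ^~ j)) => //.
  move=> t tab.
  exact: (lipschitz_comp_loc_abs_continuous (@arc_abs_continuous _ _ _ phi j)).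
exact: solution_ae_upper_rate.
Qed.

Lemma solution_flow_expR (a b : R) j (l : R) : a <= b -> (forall x, 0 <= V x) ->
  `[a, b] `<=` time_slice (arc_dom phi) j ->
  (forall t, a < t < b -> (flow_deriv H V (phi t j) <= (l * V (phi t j))%:E)%E) ->
  V (phi b j) <= expR (l * (b - a)) * V (phi a j).
Proof.
move=> ab V0 sub Vl; apply: (ae_upper_rate_expR (f := V \o phi ^~ j)) => //.
  by move=> t; exact: V0.
  move=> t tab.
  exact: (lipschitz_comp_loc_abs_continuous (@arc_abs_continuous _ _ _ phi j)).
exact: solution_ae_upper_rate.
Qed.

(** The end of a flow interval may lie outside [C], but it is a limit of earlier points of the flow,
    which are in [C]. *)
Lemma solution_in_closure t j : arc_dom phi (t, j) ->
  closure (flow_set H `|` jump_set H `|` jump_image H) (phi t j).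
Proof.
set X := closure _; pose Q t j := X (phi t j).
have subC : closure (flow_set H) `<=` X.
  by apply: closureS => x; left; left.
have subX : flow_set H `|` jump_set H `|` jump_image H `<=` X by exact: subset_closure.
have h : forall t j, arc_dom phi (t, j) -> 0 <= t /\ Q t j.
  apply: arc_dom_ind.
  - by case: (sol_init phi_sol) => [/subC//|?]; apply: subX; left; right.
  - move=> s u k _; rewrite le_eqVlt => /predU1P[->//|su] sub _.
    apply: subC => U Un; have suu : s <= u <= u by rewrite lexx ltW.
    have [d d0 hd] :=
      curve_near (@arc_abs_continuous _ _ _ phi k) (ltW su) sub suu Un.
    pose r := Num.max ((s + u) / 2) (u - d / 2).
    have r1 : (s + u) / 2 <= r by rewrite le_max lexx.
    have r2 : u - d / 2 <= r by rewrite le_max lexx orbT.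
    have r3 : r < u by rewrite gt_max; apply/andP; split; lra.
    exists (phi r k); split.
      by apply: (solution_flow_set sub); apply/andP; split; lra.
    by apply: hd; [apply/andP; split; lra|rewrite ltr_norml; apply/andP; split; lra].
  - move=> s k _ d1 d2 _; have [? ?] := sol_jump phi_sol d1 d2.
    by apply: subX; right; exists (phi s k).
by move=> /h[].
Qed.

End solutions.

(** * Stability from estimates on the Lyapunov function *)

(** Near each [x] of [K] the function exceeds [rho x / 2], hence every smaller [m]. Compactness, in
    the form of near coverings with [m] tending to 0 from the right, makes one [m] work on all of
    [K]. *)
Lemma compact_lower_semicontinuous_gt0 (R : realType) (T : topologicalType)
    (K : set T) (rho : T -> R) : compact K ->
  lower_semicontinuous (EFin \o rho) -> (forall x, K x -> 0 < rho x) ->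
  exists2 m, 0 < m & forall x, K x -> m <= rho x.
Proof.
move=> /compact_near_coveringP cK lsc rho0.
have H : \forall m \near (0 : R)^'+, K `<=` [set x | m < rho x].
  apply: (cK _ _ (fun m x => m < rho x)) => x Kx.
  have r2 : rho x / 2 < rho x by have := rho0 x Kx; lra.
  have [U Ux hU] := lsc x (rho x / 2) r2.
  exists (U, [set m | m < rho x / 2]) => /=.
    split; first exact: Ux.
    by apply: nbhs_right_lt; rewrite divr_gt0// rho0.
  move=> [y m] /= [Uy mx]; apply: lt_trans mx _.
  by have := hU y Uy; rewrite lte_fin.
have [m [m0 Km]] : exists m : R, 0 < m /\ K `<=` [set x | m < rho x].
  near (0 : R)^'+ => m; exists m; split; first by near: m; exact: nbhs_right_gt.
  by near: m.
by exists m => // x /Km/ltW.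
Unshelve. all: by end_near. Qed.

Section estimates.
Context {R : realType} {n : nat} (M : C1manifold R n) (H : hybrid_system M).
Context (A : set M) (V : M -> R).
Hypothesis A_compact : compact A.
Hypothesis V_ge0 : forall x, 0 <= V x.
Hypothesis V_lyap : lyapunov_candidate H [set: M] A [set: M] V.
Hypothesis V_proper : proper_function V.

(** The closed set on which [V] is positive definite by assumption and in which all solutions
    remain. *)
Let X := closure (flow_set H `|` jump_set H `|` jump_image H).

Lemma lyapunov_locally_lipschitz : locally_lipschitz_on setT V.
Proof.
by move=> x _; have [W [_ CO _ lip]] := lyap_lipschitz V_lyap; apply/lip/CO; right.
Qed.

Lemma lyapunov_continuous : continuous V.
Proof. exact/continuous_subspace_setT/(lyap_continuous V_lyap).2. Qed.

Lemma lyapunov_eq0 x : X x -> V x = 0 <-> A x.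
Proof. by move=> /(lyap_posdef V_lyap (x := x) I)[]. Qed.

Lemma open_sublevel c : open [set x | V x < c].
Proof.
apply: (open_comp (f := V) (D := [set y : R | y < c])); last exact: open_lt.
by move=> x _; exact: lyapunov_continuous.
Qed.

Lemma closed_superlevel c : closed [set x | c <= V x].
Proof.
apply: (closed_comp (f := V) (D := [set y : R | c <= y])); last exact: closed_ge.
by move=> x _; exact: lyapunov_continuous.
Qed.

Lemma compact_lyapunov_bounded (K : set M) : compact K ->
  exists2 c, 0 < c & forall x, K x -> V x <= c.
Proof.
move=> cK; have [->|K0] := eqVneq K set0; first by exists 1.
have [||x [_ xK]] := compact_EVT_max (f := V) _ cK.
  exact/set0P.
  by apply: continuous_subspaceT; exact: lyapunov_continuous.
exists (V x + 1); first by have := V_ge0 x; lra.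
by move=> y /mem_set /xK; lra.
Qed.

Lemma sublevel_compact_nbhd c : exists2 c', c <= c' &
  compact_nbhd A [set x | V x <= c'].
Proof.
have [b b0 Ab] := compact_lyapunov_bounded A_compact.
(* [V] is at most [b] on [A], so the [+ 1] puts [A] in the open sublevel set, hence in the
   interior. *)
exists (Num.max c (b + 1)); first by rewrite le_max lexx.
split; first exact: V_proper.
move=> x /Ab Vx; apply: (@filterS _ _ _ [set x | V x < Num.max c (b + 1)]).
  by move=> y /= /ltW.
apply: open_nbhs_nbhs; split; first exact: open_sublevel.
by rewrite /= lt_max; apply/orP; right; lra.
Qed.

(** [rho] vanishes on [A], and only inside [X] does [0 < r <= V x] exclude points of [A]; hence the
    restriction to [X]. *)
Lemma class_PD_lower_bound (rho : M -> R) r c :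
  lower_semicontinuous (EFin \o rho) -> class_PD A rho -> 0 < r ->
  exists2 m, 0 < m & forall x, X x -> r <= V x <= c -> m <= rho x.
Proof.
move=> lsc pd r0.
have cK : compact ([set x | V x <= c] `&` (X `&` [set x | r <= V x])).
  apply: compact_closedI; first exact: V_proper.
  by apply: closedI; [exact: closed_closure|exact: closed_superlevel].
have [x [_ [Xx rx]]|m m0 hm] := compact_lower_semicontinuous_gt0 cK lsc.
  rewrite lt_neqAle eq_sym (pd x).1 andbT; apply/eqP => /(pd x).2.
  by move=> /(lyapunov_eq0 Xx) V0; move: rx; rewrite /= V0; lra.
by exists m => // x Xx /andP[rx xc]; apply: hm.
Qed.

(** On the compact part of [X] with [V <= 1] outside the interior of [U], [V] attains a minimum,
    positive since [A] is avoided. Half of it, capped by 1, serves as [e]. *)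
Lemma sublevel_sub_nbhd (U : set M) : A `<=` U° -> exists2 e, 0 < e &
  forall x, X x -> V x <= e -> U x.
Proof.
move=> AU.
have cK : compact ([set x | V x <= 1] `&` (X `&` ~` U°)).
  apply: compact_closedI; first exact: V_proper.
  apply: closedI; first exact: closed_closure.
  by apply: open_closedC; exact: open_interior.
have [K0|K0] := eqVneq ([set x | V x <= 1] `&` (X `&` ~` U°)) set0.
  exists 1 => // x Xx xe; apply: contrapT => nU.
  suff : set0 x by [].
  by rewrite -K0; split => //; split => // /interior_subset.
have [||x [/set_mem[_ [Xx nUx]] xK]] := compact_EVT_min (f := V) _ cK.
  exact/set0P.
  by apply: continuous_subspaceT; exact: lyapunov_continuous.
have Vx : 0 < V x.
  rewrite lt_neqAle V_ge0 andbT eq_sym; apply/eqP => /(lyapunov_eq0 Xx).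
  by move/AU.
exists (Num.min 1 (V x / 2)); first by rewrite lt_min ltr01 divr_gt0.
move=> y Xy; rewrite le_min => /andP[y1 yx]; apply: contrapT => nU.
have : V x <= V y.
  by apply/xK/mem_set; split => //; split => // /interior_subset.
lra.
Qed.

Hypothesis bounded : forall c, exists B, forall phi, is_solution H phi ->
  0 < V (phi 0 0%N) <= c -> forall t j, arc_dom phi (t, j) -> V (phi t j) <= B.
Hypothesis stable : forall e, 0 < e -> exists2 d, 0 < d &
  forall phi, is_solution H phi -> 0 < V (phi 0 0%N) <= d ->
  forall t j, arc_dom phi (t, j) -> V (phi t j) <= e.
Hypothesis attractive : forall c e, 0 < e -> exists N,
  forall phi, is_solution H phi -> 0 < V (phi 0 0%N) <= c ->
  forall t j, arc_dom phi (t, j) -> N <= t + j%:R -> V (phi t j) <= e.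
Hypothesis invariant : forall phi, is_solution H phi -> V (phi 0 0%N) = 0 ->
  forall t j, arc_dom phi (t, j) -> V (phi t j) = 0.

Lemma uniformly_globally_pre_asymptotically_stable_of_estimates :
  uniformly_globally_pre_asymptotically_stable H A.
Proof.
have X0 phi : is_solution H phi -> X (phi 0 0%N).
  move=> s; case: (sol_init s) => [|h]; last by apply: subset_closure; left; right.
  by apply: closureS => x; left; left.
have XP phi t j : is_solution H phi -> arc_dom phi (t, j) -> X (phi t j).
  by move=> s; exact: solution_in_closure.
have V00 phi : is_solution H phi -> V (phi 0 0%N) = 0 \/ 0 < V (phi 0 0%N).
  move=> s; have := V_ge0 (phi 0 0%N); rewrite le_eqVlt => /orP[/eqP <-|]; auto.
split; [split|].
- move=> U AU; have [e e0 eU] := sublevel_sub_nbhd AU.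
  have [d d0 hd] := stable e0.
  (* A point of [A] outside [X] may have [V >= d]. Adding the open complement of [X], where no
     solution starts, makes this a neighbourhood of [A]. *)
  exists (~` X `|` [set x | V x < d]).
    move=> x Ax; have oW : open (~` X `|` [set x | V x < d]).
      apply: openU; last exact: open_sublevel.
      exact/closed_openC/closed_closure.
    apply: open_nbhs_nbhs; split => //.
    have [Xx|] := pselect (X x); last by left.
    by right; rewrite /= (lyapunov_eq0 Xx).2.
  move=> phi [[s _] W0] _ [[t j] dtj <-] /=.
  apply: eU; first exact: XP.
  have [z|p] := V00 phi s; first by rewrite (invariant s z dtj) ltW.
  apply: hd dtj => //; rewrite p/=; case: W0 => [nX|/ltW//].
  by have := X0 phi s.
- move=> W [cW AW]; have [c c0 Wc] := compact_lyapunov_bounded cW.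
  have [B hB] := bounded c.
  (* The maximum with 0 accommodates solutions along which [V] is zero. *)
  have [B' BB' nB] := sublevel_compact_nbhd (Num.max 0 B).
  move: BB'; rewrite ge_max => /andP[B'0 BB'].
  exists [set x | V x <= B'] => // phi [[s _] W0] _ [[t j] dtj <-] /=.
  have [z|p] := V00 phi s; first by rewrite (invariant s z dtj).
  by apply: le_trans BB'; apply: hB dtj => //; rewrite p/= Wc.
- move=> U W [cU _] [_ AW].
  have [c c0 Uc] := compact_lyapunov_bounded cU.
  have [e e0 eW] := sublevel_sub_nbhd AW.
  have [N hN] := attractive c e0.
  exists (Num.max 0 N); first by rewrite le_max lexx.
  move=> phi [[s _] U0] t j dtj; rewrite ge_max => /andP[_ Ntj].
  apply: eW; first exact: XP.
  have [z|p] := V00 phi s; first by rewrite (invariant s z dtj) ltW.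
  by apply: (hN phi s _ _ _ dtj) => //; rewrite p/= Uc.
Qed.

End estimates.

(** * The six conditions *)

Section cases.
Context {R : realType} {n : nat} (M : C1manifold R n) (H : hybrid_system M).
Context (A : set M) (V : M -> R).
Hypothesis A_compact : compact A.
Hypothesis V_ge0 : forall x, 0 <= V x.
Hypothesis V_lyap : lyapunov_candidate H [set: M] A [set: M] V.
Hypothesis V_proper : proper_function V.

Let X := closure (flow_set H `|` jump_set H `|` jump_image H).
Let Vlip := lyapunov_locally_lipschitz V_lyap.

Lemma flow_set_closure x : flow_set H x -> X x.
Proof. by move=> Cx; apply: subset_closure; left; left. Qed.

Lemma jump_set_closure x : jump_set H x -> X x.
Proof. by move=> Dx; apply: subset_closure; left; right. Qed.

(** Links bounds on the initial value of [V] to the conditions on hybrid times, which are stated for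
    starts in a compact neighbourhood of [A] minus [A]. *)
Lemma sublevel_solutions c : exists2 K : set M, compact_nbhd A K &
  forall phi, is_solution H phi -> 0 < V (phi 0 0%N) <= c ->
    solutions_from H (K `\` A) phi.
Proof.
have [c' cc' nK] := sublevel_compact_nbhd A_compact V_ge0 V_lyap V_proper c.
exists [set x | V x <= c'] => // phi s /andP[V0 Vc]; split => //.
split; first exact: le_trans cc'.
have X0 : X (phi 0 0%N).
  case: (sol_init s) => [|/jump_set_closure//].
  by apply: closureS => x; left; left.
by move=> /(lyapunov_eq0 V_lyap X0) V00; rewrite V00 ltxx in V0.
Qed.

Section nonincreasing.
Hypothesis flow_le0 : forall x, flow_set H x -> (flow_deriv H V x <= 0%:E)%E.
Hypothesis jump_le0 : forall x, jump_set H x -> (jump_diff H V x <= 0%:E)%E.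

Lemma flow_nonincreasing phi a b j : is_solution H phi -> a <= b ->
  `[a, b] `<=` time_slice (arc_dom phi) j -> V (phi b j) <= V (phi a j).
Proof.
move=> s ab sub; rewrite -subr_le0 -(mul0r (b - a)).
apply: (solution_flow_le Vlip s ab sub) => t tab.
exact/flow_le0/(solution_flow_set s sub tab).
Qed.

Lemma solution_nonincreasing phi t j : is_solution H phi -> arc_dom phi (t, j) ->
  V (phi t j) <= V (phi 0 0%N).
Proof.
move=> s dtj; pose Q t j := V (phi t j) <= V (phi 0 0%N).
suff h : forall t j, arc_dom phi (t, j) -> 0 <= t /\ Q t j by have [] := h t j dtj.
apply: arc_dom_ind; rewrite /Q => //.
  by move=> a b k _ ab sub; apply: le_trans; exact: flow_nonincreasing.
move=> r k _ d1 d2; apply: le_trans; have [Dr rk] := sol_jump s d1 d2.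
by have := jump_diff_le rk (jump_le0 Dr); rewrite addr0.
Qed.

(** Once [V <= r], this persists by monotonicity. Until then [V] has stayed between [r] and [c], and
    the guaranteed decrease has accumulated. *)
Lemma solution_decrease phi r c mC mD : is_solution H phi -> V (phi 0 0%N) <= c ->
  0 <= mC -> 0 <= mD ->
  (forall x, flow_set H x -> r <= V x <= c -> (flow_deriv H V x <= (- mC)%:E)%E) ->
  (forall x, jump_set H x -> r <= V x <= c -> (jump_diff H V x <= (- mD)%:E)%E) ->
  forall t j, arc_dom phi (t, j) ->
    V (phi t j) <= r \/ mC * t + mD * j%:R <= c - V (phi t j).
Proof.
move=> s V0c mC0 mD0 hC hD t0 j0 d0.
pose Q t j := V (phi t j) <= r \/ mC * t + mD * j%:R <= c - V (phi t j).
suff h : forall t j, arc_dom phi (t, j) -> 0 <= t /\ Q t j by have [] := h _ _ d0.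
apply: arc_dom_ind; rewrite /Q.
- by right; rewrite !mulr0; lra.
- move=> a b j a0 ab sub; have mono := flow_nonincreasing s ab sub.
  have mDj : 0 <= mD * j%:R by exact: mulr_ge0.
  have mCa : 0 <= mC * a by exact: mulr_ge0.
  case=> [ar|ha]; first by left; lra.
  have [br|br] := leP (V (phi b j)) r; first by left.
  (* [V] still exceeds [r] at [b], hence on the whole flow interval, so the rate [mC] applies
     throughout. *)
  right; suff : V (phi b j) - V (phi a j) <= - mC * (b - a) by lra.
  apply: (solution_flow_le Vlip s ab sub) => t tab.
  have [/ltW at_ /ltW tb] := andP tab.
  apply: hC; first exact: (solution_flow_set s sub tab).
  have : V (phi b j) <= V (phi t j).
    apply: flow_nonincreasing => // x; rewrite /= in_itv/= => /andP[tx xb].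
    by apply: sub; rewrite /= in_itv/=; apply/andP; split; lra.
  have : V (phi t j) <= V (phi a j).
    apply: flow_nonincreasing => // x; rewrite /= in_itv/= => /andP[ax xt].
    by apply: sub; rewrite /= in_itv/=; apply/andP; split; lra.
  by move=> ? ?; apply/andP; split; lra.
- move=> t j t_ge0 d1 d2; have [Dt tj] := sol_jump s d1 d2.
  have := jump_diff_le tj (jump_le0 Dt); rewrite addr0 => mono.
  have mDj : 0 <= mD * j%:R by exact: mulr_ge0.
  have mCt : 0 <= mC * t by exact: mulr_ge0.
  case=> [tr|ht]; first by left; lra.
  have [tr|tr] := leP (V (phi t j)) r; first by left; lra.
  right; have : V (phi t j.+1) <= V (phi t j) + - mD.
    apply: jump_diff_le tj _; apply: hD => //; apply/andP; split; lra.
  rewrite -natr1; lra.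
Qed.

(* [t] and [j] need not both be controlled by the decrease of [V]: one of the
   rates may vanish, as long as the other one bounds [t + j]. *)
Lemma stable_of_decrease :
  (forall r c, 0 < r -> 0 < c -> exists mC mD N, [/\ 0 <= mC, 0 <= mD,
    forall x, flow_set H x -> r <= V x <= c -> (flow_deriv H V x <= (- mC)%:E)%E,
    forall x, jump_set H x -> r <= V x <= c -> (jump_diff H V x <= (- mD)%:E)%E
    & forall phi, is_solution H phi -> 0 < V (phi 0 0%N) <= c ->
      forall t j, 0 <= t -> arc_dom phi (t, j) -> mC * t + mD * j%:R <= c ->
        t + j%:R < N]) ->
  uniformly_globally_pre_asymptotically_stable H A.
Proof.
move=> dec.
apply: (@uniformly_globally_pre_asymptotically_stable_of_estimates _ _ _ H A V) => //.
- move=> c; exists c => phi s /andP[_ Vc] t j dtj.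
  exact: le_trans (solution_nonincreasing s dtj) Vc.
- move=> e e0; exists e => // phi s /andP[_ Vc] t j dtj.
  exact: le_trans (solution_nonincreasing s dtj) Vc.
- move=> c e e0; have [c0|c0] := leP c 0.
    by exists 0 => phi s /andP[V0 Vc]; lra.
  have [mC [mD [N [mC0 mD0 hC hD hN]]]] := dec e c e0 c0.
  exists N => phi s V0c t j dtj Ntj; have /andP[V0 Vc] := V0c.
  have [//|h] := solution_decrease s Vc mC0 mD0 hC hD dtj.
  have t0 := solution_time_ge0 dtj.
  have := hN phi s V0c t j t0 dtj; have := V_ge0 (phi t j) => ? /(_ _); lra.
- move=> phi s V0 t j dtj; apply/eqP; rewrite eq_le V_ge0 andbT.
  by rewrite -V0; exact: solution_nonincreasing.
Qed.

End nonincreasing.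

Lemma stable_strict_decrease rhoC rhoD :
  lower_semicontinuous (EFin \o rhoC) -> class_PD A rhoC ->
  lower_semicontinuous (EFin \o rhoD) -> class_PD A rhoD ->
  (forall x, flow_set H x -> (flow_deriv H V x <= (- rhoC x)%:E)%E) ->
  (forall x, jump_set H x -> (jump_diff H V x <= (- rhoD x)%:E)%E) ->
  uniformly_globally_pre_asymptotically_stable H A.
Proof.
move=> lC pC lD pD hC hD; apply: stable_of_decrease.
- by move=> x /hC/le_trans; apply; rewrite lee_fin oppr_le0; exact: (pC x).1.
- by move=> x /hD/le_trans; apply; rewrite lee_fin oppr_le0; exact: (pD x).1.
move=> r c r0 c0.
have [mC mC0 rC] := class_PD_lower_bound V_lyap V_proper c lC pC r0.
have [mD mD0 rD] := class_PD_lower_bound V_lyap V_proper c lD pD r0.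
(* Both summands of [mC * t + mD * j%:R <= c] are nonnegative, which bounds [t] and [j] separately;
   the [+ 1] makes the bound strict. *)
exists mC, mD, (c / mC + c / mD + 1); split; [exact: ltW|exact: ltW|..].
- move=> x Cx rx; apply: le_trans (hC x Cx) _; rewrite lee_fin lerN2.
  by apply: rC rx; exact: flow_set_closure.
- move=> x Dx rx; apply: le_trans (hD x Dx) _; rewrite lee_fin lerN2.
  by apply: rD rx; exact: jump_set_closure.
- move=> phi s _ t j t0 _ h.
  have h1 : 0 <= mC * t by rewrite mulr_ge0// ltW.
  have h2 : 0 <= mD * j%:R by rewrite mulr_ge0// ltW.
  have : t <= c / mC by rewrite ler_pdivlMr// mulrC; lra.
  have : j%:R <= c / mD by rewrite ler_pdivlMr// mulrC; lra.
  lra.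
Qed.

(** Stands in for the inverse of [gamma]: by unboundedness [gamma] exceeds [B] at some [s], and by
    monotonicity from there on. *)
Lemma class_Koo_lt_inv (gamma : R -> R) B : class_Koo gamma ->
  exists s, forall t, gamma t <= B -> t < s.
Proof.
move=> [_ _ mono unb]; have [s s0 sB] := unb B; exists s => t tB.
rewrite ltNge; apply/negP; rewrite le_eqVlt => /predU1P[st|/(mono s t s0)].
  by move: tB; rewrite -st; lra.
lra.
Qed.

(** The decrease bounds only the flow time, by [c / mC]; the condition on hybrid times then gives
    [gamma (t + j) <= N + c / mC], which bounds [t + j]. *)
Lemma stable_flow_decrease rhoC :
  lower_semicontinuous (EFin \o rhoC) -> class_PD A rhoC ->
  (forall x, flow_set H x -> (flow_deriv H V x <= (- rhoC x)%:E)%E) ->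
  (forall x, jump_set H x -> (jump_diff H V x <= 0%:E)%E) ->
  (forall K : set M, compact_nbhd A K ->
     exists (gamma : R -> R) (N : R), [/\ class_Koo gamma, 0 <= N &
       forall phi, solutions_from H (K `\` A) phi ->
       forall t j, arc_dom phi (t, j) -> gamma (t + j%:R) - N <= t]) ->
  uniformly_globally_pre_asymptotically_stable H A.
Proof.
move=> lC pC hC hD per; apply: stable_of_decrease => //.
- by move=> x /hC/le_trans; apply; rewrite lee_fin oppr_le0; exact: (pC x).1.
move=> r c r0 c0.
have [mC mC0 rC] := class_PD_lower_bound V_lyap V_proper c lC pC r0.
have [K nK Kc] := sublevel_solutions c.
have [gamma [N [gK N0 hg]]] := per K nK.
have [s hs] := class_Koo_lt_inv (N + c / mC) gK.
exists mC, 0, s; split => //; first exact: ltW.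
- move=> x Cx rx; apply: le_trans (hC x Cx) _; rewrite lee_fin lerN2.
  by apply: rC rx; exact: flow_set_closure.
- by move=> x Dx _; rewrite oppr0; exact: hD.
- move=> phi sol V0 t j t0 dtj; rewrite mul0r addr0 => h; apply: hs.
  have : t <= c / mC by rewrite ler_pdivlMr// mulrC.
  have := hg phi (Kc phi sol V0) t j dtj; lra.
Qed.

Lemma stable_jump_decrease rhoD :
  lower_semicontinuous (EFin \o rhoD) -> class_PD A rhoD ->
  (forall x, jump_set H x -> (jump_diff H V x <= (- rhoD x)%:E)%E) ->
  (forall x, flow_set H x -> (flow_deriv H V x <= 0%:E)%E) ->
  (forall K : set M, compact_nbhd A K ->
     exists (gamma : R -> R) (N : R), [/\ class_Koo gamma, 0 <= N &
       forall phi, solutions_from H (K `\` A) phi ->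
       forall t j, arc_dom phi (t, j) -> gamma (t + j%:R) - N <= j%:R]) ->
  uniformly_globally_pre_asymptotically_stable H A.
Proof.
move=> lD pD hD hC per; apply: stable_of_decrease => //.
- by move=> x /hD/le_trans; apply; rewrite lee_fin oppr_le0; exact: (pD x).1.
move=> r c r0 c0.
have [mD mD0 rD] := class_PD_lower_bound V_lyap V_proper c lD pD r0.
have [K nK Kc] := sublevel_solutions c.
have [gamma [N [gK N0 hg]]] := per K nK.
have [s hs] := class_Koo_lt_inv (N + c / mD) gK.
exists 0, mD, s; split => //; first exact: ltW.
- by move=> x Cx _; rewrite oppr0; exact: hC.
- move=> x Dx rx; apply: le_trans (hD x Dx) _; rewrite lee_fin lerN2.
  by apply: rD rx; exact: jump_set_closure.
- move=> phi sol V0 t j t0 dtj; rewrite mul0r add0r => h; apply: hs.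
  have : j%:R <= c / mD by rewrite ler_pdivlMr// mulrC.
  have := hg phi (Kc phi sol V0) t j dtj; lra.
Qed.

End cases.

(** * Iterated bounds on the growth at jumps *)

Section class_Koo_iterates.
Context {R : realType} (lambda : R -> R).
Hypothesis lambdaK : class_Koo lambda.

(** [lambda] may lie below the identity. The maximum makes the iterates increase with their number,
    so a bound for [J] jumps also covers fewer jumps. *)
Let L s := Num.max s (lambda s).

Lemma class_Koo_le s t : 0 <= s -> s <= t -> lambda s <= lambda t.
Proof.
move=> s0; rewrite le_eqVlt => /predU1P[->//|st].
by have [_ _ mono _] := lambdaK; exact/ltW/mono.
Qed.

Lemma max_class_Koo_le s t : 0 <= s -> s <= t -> L s <= L t.
Proof.
move=> s0 st; rewrite /L ge_max !le_max st/=; apply/orP; right.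
exact: class_Koo_le.
Qed.

Lemma le_iter_max j s : s <= iter j L s.
Proof.
by elim: j => //= j IH; apply: (le_trans IH); rewrite /L le_max lexx.
Qed.

Lemma iter_max_le j s t : 0 <= s -> s <= t -> iter j L s <= iter j L t.
Proof.
move=> s0 st; elim: j => //= j IH; apply: max_class_Koo_le => //.
exact: le_trans (le_iter_max j s).
Qed.

Lemma iter_max_leq i j s : (i <= j)%N -> iter i L s <= iter j L s.
Proof. by move=> /subnK <-; rewrite iterD; exact: le_iter_max. Qed.

Lemma iter_max0 j : iter j L 0 = 0.
Proof.
elim: j => //= j ->; have [l0 _ _ _] := lambdaK.
by rewrite /L l0 maxxx.
Qed.

(** Continuity of [lambda] at 0 yields [d1] with [L d1 <= e]; the induction hypothesis brings the
    first [j] iterates below [d1]. *)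
Lemma iter_max_small j e : 0 < e -> exists2 d, 0 < d & iter j L d <= e.
Proof.
elim: j e => [|j IH] e e0; first by exists e.
have [d1 d10 Ld1] : exists2 d, 0 < d & L d <= e.
  have [l0 lc _ _] := lambdaK.
  have /cvgrPdist_lt/(_ e e0) := (subspace_continuousP _ _).1 lc 0 (lexx 0).
  rewrite near_withinE => -[d /= d0 hd].
  pose d' := Num.min e (d / 2).
  have d'0 : 0 < d' by rewrite lt_min e0 divr_gt0.
  have [d'e d'd] : d' <= e /\ d' <= d / 2 by rewrite !ge_min !lexx orbT.
  exists d' => //; rewrite ge_max d'e/=.
  have : `|lambda 0 - lambda d'| < e.
    apply: hd; last exact: ltW.
    by rewrite /= sub0r normrN gtr0_norm//; lra.
  by rewrite l0 sub0r normrN => h; apply/ltW/(le_lt_trans (ler_norm _) h).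
have [d d0 Ld] := IH d1 d10.
exists d => //=; apply: le_trans Ld1; apply: max_class_Koo_le => //.
exact: le_trans (ltW d0) (le_iter_max j d).
Qed.

End class_Koo_iterates.

(** * Balanced growth, bounded flow time, bounded number of jumps *)

Section cases.
Context {R : realType} {n : nat} (M : C1manifold R n) (H : hybrid_system M).
Context (A : set M) (V : M -> R).
Hypothesis A_compact : compact A.
Hypothesis V_ge0 : forall x, 0 <= V x.
Hypothesis V_lyap : lyapunov_candidate H [set: M] A [set: M] V.
Hypothesis V_proper : proper_function V.

Let Vlip := lyapunov_locally_lipschitz V_lyap.

Lemma solution_expR_le lc ld phi t j : is_solution H phi ->
  (forall x, flow_set H x -> (flow_deriv H V x <= (lc * V x)%:E)%E) ->
  (forall x, jump_set H x -> (jump_diff H V x <= ((expR ld - 1) * V x)%:E)%E) ->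
  arc_dom phi (t, j) ->
  V (phi t j) <= expR (lc * t + ld * j%:R) * V (phi 0 0%N).
Proof.
move=> s hC hD dtj.
pose Q t j := V (phi t j) <= expR (lc * t + ld * j%:R) * V (phi 0 0%N).
suff h : forall t j, arc_dom phi (t, j) -> 0 <= t /\ Q t j by have [] := h _ _ dtj.
apply: arc_dom_ind; rewrite /Q.
- by rewrite !mulr0 addr0 expR0 mul1r.
- move=> a b k _ ab sub h.
  have := solution_flow_expR Vlip s ab V_ge0 sub => /(_ lc) h1.
  apply: le_trans (h1 _) _ => [u uab|].
    exact/hC/(solution_flow_set s sub uab).
  have -> : lc * b + ld * k%:R = lc * (b - a) + (lc * a + ld * k%:R) by ring.
  by rewrite expRD -mulrA; apply: ler_wpM2l => //; exact: expR_ge0.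
- move=> u k _ d1 d2 h; have [Du uk] := sol_jump s d1 d2.
  apply: le_trans (jump_diff_le uk (hD _ Du)) _.
  have -> : lc * u + ld * k.+1%:R = ld + (lc * u + ld * k%:R) by rewrite -natr1; ring.
  have -> : forall z : R, z + (expR ld - 1) * z = expR ld * z by move=> z; ring.
  by rewrite expRD -mulrA; apply: ler_wpM2l => //; exact: expR_ge0.
Qed.

Lemma stable_balanced lc ld M0 gamma :
  (forall x, flow_set H x -> (flow_deriv H V x <= (lc * V x)%:E)%E) ->
  (forall x, jump_set H x -> (jump_diff H V x <= ((expR ld - 1) * V x)%:E)%E) ->
  0 < M0 -> 0 < gamma ->
  (forall phi, is_solution H phi -> forall t j, arc_dom phi (t, j) ->
     lc * t + ld * j%:R <= M0 - gamma * (t + j%:R)) ->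
  uniformly_globally_pre_asymptotically_stable H A.
Proof.
move=> hC hD M00 g0 per.
have est phi t j : is_solution H phi -> arc_dom phi (t, j) ->
    V (phi t j) <= expR (M0 - gamma * (t + j%:R)) * V (phi 0 0%N).
  move=> s dtj; apply: le_trans (solution_expR_le s hC hD dtj) _.
  by apply: ler_wpM2r => //; rewrite ler_expR; exact: (per phi s t j dtj).
have est0 phi t j : is_solution H phi -> arc_dom phi (t, j) ->
    V (phi t j) <= expR M0 * V (phi 0 0%N).
  move=> s dtj; apply: le_trans (est _ _ _ s dtj) _.
  apply: ler_wpM2r => //; rewrite ler_expR gerDl oppr_le0.
  by rewrite mulr_ge0 ?(ltW g0)// addr_ge0// (solution_time_ge0 dtj).
have E0 := expR_gt0 M0.
apply: (@uniformly_globally_pre_asymptotically_stable_of_estimates _ _ _ H A V) => //.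
- move=> c; exists (expR M0 * c) => phi s /andP[_ Vc] t j dtj.
  by apply: le_trans (est0 _ _ _ s dtj) _; rewrite ler_pM2l.
- move=> e e0; exists (e / expR M0); first exact: divr_gt0.
  move=> phi s /andP[_ Vc] t j dtj; apply: le_trans (est0 _ _ _ s dtj) _.
  by rewrite mulrC -ler_pdivlMr.
- move=> c e e0; have [c0|c0] := leP c 0.
    by exists 0 => phi s /andP[V0 Vc]; lra.
  (* Beyond this time the exponent is at most [- (c / e)], and [expR (- x) <= x^-1] turns the factor
     into at most [e / c]. *)
  exists ((M0 + c / e) / gamma) => phi s /andP[_ Vc] t j dtj.
  rewrite ler_pdivrMr// => Ntj; apply: le_trans (est _ _ _ s dtj) _.
  have ce : 0 < c / e by rewrite divr_gt0.
  have h1 : expR (M0 - gamma * (t + j%:R)) <= expR (- (c / e)).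
    by rewrite ler_expR; lra.
  have h2 : expR (- (c / e)) <= (c / e)^-1.
    rewrite expRN lef_pV2 ?posrE ?expR_gt0//.
    by have := expR_ge1Dx (c / e); lra.
  have -> : e = (c / e)^-1 * c by field; lra.
  by apply: ler_pM => //; exact: le_trans h2.
- move=> phi s V0 t j dtj; apply/eqP; rewrite eq_le V_ge0 andbT.
  by apply: le_trans (est0 _ _ _ s dtj) _; rewrite V0 mulr0.
Qed.

(** Flow may increase [V], by a factor [expR (k * t)] in total, which is at most [E] since flow time
    is bounded. Measured against this factor, [V] is nonincreasing and loses at least [m] at each
    jump until it falls below [r]. *)
Lemma stable_bounded_flow_time rhoD l :
  lower_semicontinuous (EFin \o rhoD) -> class_PD A rhoD ->
  (forall x, jump_set H x -> (jump_diff H V x <= (- rhoD x)%:E)%E) ->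
  (forall x, flow_set H x -> (flow_deriv H V x <= (l * V x)%:E)%E) ->
  (forall K : set M, compact_nbhd A K -> exists2 T : R, 0 <= T &
     forall phi, solutions_from H (K `\` A) phi -> (sup_t phi <= T%:E)%E) ->
  uniformly_globally_pre_asymptotically_stable H A.
Proof.
(* With [k = |l|] in place of [l], the growth factor [expR (k * t)] is at least 1 and nondecreasing
   in [t]. *)
move=> lD pD hD hC0 per; pose k := `|l|; have k0 : 0 <= k by exact: normr_ge0.
have hC x : flow_set H x -> (flow_deriv H V x <= (k * V x)%:E)%E.
  move=> Cx; apply: le_trans (hC0 x Cx) _; rewrite lee_fin.
  by apply: ler_wpM2r => //; exact: ler_norm.
have hJ x : jump_set H x -> (jump_diff H V x <= ((expR 0 - 1) * V x)%:E)%E.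
  move=> Dx; apply: le_trans (hD x Dx) _; rewrite lee_fin expR0 subrr mul0r.
  by rewrite oppr_le0; exact: (pD x).1.
have est phi t j : is_solution H phi -> arc_dom phi (t, j) ->
    V (phi t j) <= expR (k * t) * V (phi 0 0%N).
  move=> s dtj; have := solution_expR_le s hC hJ dtj.
  by rewrite mul0r addr0.
have time c : exists2 T, 0 <= T & forall phi, is_solution H phi ->
    0 < V (phi 0 0%N) <= c -> forall t j, arc_dom phi (t, j) ->
    expR (k * t) <= expR (k * T) /\ t <= T.
  have [K nK Kc] := sublevel_solutions A_compact V_ge0 V_lyap V_proper c.
  have [T T0 hT] := per K nK; exists T => // phi s V0 t j dtj.
  have tT : t <= T.
    rewrite -lee_fin; apply: le_trans (hT phi (Kc phi s V0)).
    by apply: ereal_sup_ubound; exists (t, j).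
  by split => //; rewrite ler_expR; exact: ler_wpM2l.
apply: (@uniformly_globally_pre_asymptotically_stable_of_estimates _ _ _ H A V) => //.
- move=> c; have [T T0 hT] := time c; exists (expR (k * T) * c).
  move=> phi s V0c t j dtj; apply: le_trans (est _ _ _ s dtj) _.
  have [eT _] := hT phi s V0c t j dtj; have /andP[_ Vc] := V0c.
  by apply: ler_pM => //; exact: expR_ge0.
(* The time bound depends on the initial sublevel set, so level 1 is fixed before the smaller level
   is chosen. *)
- move=> e e0; have [T T0 hT] := time 1.
  have E0 := expR_gt0 (k * T).
  exists (Num.min 1 (e / expR (k * T))); first by rewrite lt_min ltr01 divr_gt0.
  move=> phi s /andP[V0]; rewrite le_min => /andP[V1 Ve] t j dtj.
  have [|eT _] := hT phi s _ t j dtj; first by rewrite V0.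
  apply: le_trans (est _ _ _ s dtj) _; move: Ve; rewrite ler_pdivlMr// mulrC.
  by apply: le_trans; exact: ler_wpM2r.
- move=> c e e0; have [T T0 hT] := time c.
  have [c0|c0] := leP c 0.
    by exists 0 => phi s /andP[V0 Vc]; lra.
  have E0 := expR_gt0 (k * T); set E := expR (k * T) in hT E0.
  (* Dividing by [E] yields [expR (k * t) * r <= e], and likewise [expR (k * t) * m <= m2] below. *)
  pose r := e / E; have r0 : 0 < r by rewrite divr_gt0.
  have [m2 m20 rD] := class_PD_lower_bound V_lyap V_proper (E * c) lD pD r0.
  pose m := m2 / E; have m0 : 0 < m by rewrite divr_gt0.
  exists (T + c / m + 1) => phi s V0c t j dtj Ntj.
  have hT' := hT phi s V0c.
  have dich : V (phi t j) <= expR (k * t) * r \/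
      V (phi t j) <= expR (k * t) * (c - m * j%:R).
    pose Q t j := arc_dom phi (t, j) -> V (phi t j) <= expR (k * t) * r \/
      V (phi t j) <= expR (k * t) * (c - m * j%:R).
    suff h : forall t j, arc_dom phi (t, j) -> 0 <= t /\ Q t j.
      by have [_] := h _ _ dtj; exact.
    apply: arc_dom_ind; rewrite /Q.
    + move=> _; right; rewrite !mulr0 expR0 mul1r subr0.
      by have /andP[] := V0c.
    + move=> a b i a0 ab sub + db.
      have da : arc_dom phi (a, i) by apply: sub; rewrite /= in_itv/= lexx.
      move=> /(_ da).
      have h1 : V (phi b i) <= expR (k * (b - a)) * V (phi a i).
        apply: (solution_flow_expR Vlip s ab V_ge0 sub) => u uab.
        exact/hC/(solution_flow_set s sub uab).
      have -> : k * b = k * (b - a) + k * a by ring.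
      rewrite expRD -!mulrA.
      by move=> [h|h]; [left|right]; apply: le_trans h1 _;
        apply: ler_wpM2l => //; exact: expR_ge0.
    + move=> u i u0 d1 d2 + _ => /(_ d1); have [Du ui] := sol_jump s d1 d2.
      have jm := jump_diff_le ui (hD _ Du).
      have rho0 := (pD (phi u i)).1.
      move=> [h|h]; first by left; lra.
      have [|ur] := leP (V (phi u i)) (expR (k * u) * r); first by left; lra.
      right; have [eT uT] := hT' u i d1.
      have e1 : 1 <= expR (k * u).
        by rewrite -expR0 ler_expR mulr_ge0.
      have m2rho : m2 <= rhoD (phi u i).
        apply: rD; first exact: jump_set_closure.
        apply/andP; split; first by apply/ltW/(le_lt_trans _ ur); rewrite ler_peMl// ltW.
        apply: (le_trans h).
        have mi : 0 <= m * i%:R by rewrite mulr_ge0// ltW.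
        apply: (@le_trans _ _ (expR (k * u) * c)).
          by apply: ler_wpM2l; [exact: expR_ge0|lra].
        by apply: ler_wpM2r => //; exact: ltW.
      have : expR (k * u) * m <= m2.
        have -> : m2 = E * m by rewrite /m; field; lra.
        by apply: ler_wpM2r => //; exact: ltW.
      by rewrite -natr1; lra.
  have [eT tT] := hT' t j dtj.
  case: dich => [h|h].
    apply: (le_trans h); have -> : e = E * r by rewrite /r; field; lra.
    by apply: ler_wpM2r => //; exact: ltW.
  have := le_trans (V_ge0 _) h; rewrite pmulr_rge0 ?expR_gt0// => h'.
  have : j%:R <= c / m by rewrite ler_pdivlMr// mulrC; lra.
  lra.
- move=> phi s V0 t j dtj; apply/eqP; rewrite eq_le V_ge0 andbT.
  by apply: le_trans (est _ _ _ s dtj) _; rewrite V0 mulr0.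
Qed.

(** [V] decreases along flows but may grow at jumps. As at most [J] jumps occur, [J] iterates of [L]
    control the total growth, and the flow time spent above the small levels is bounded. *)
Lemma stable_bounded_jumps rhoC lambda :
  lower_semicontinuous (EFin \o rhoC) -> class_PD A rhoC -> class_Koo lambda ->
  (forall x, flow_set H x -> (flow_deriv H V x <= (- rhoC x)%:E)%E) ->
  (forall x chi, jump_set H x -> jump_map H x chi -> V chi <= lambda (V x)) ->
  (forall K : set M, compact_nbhd A K -> exists2 J : R, 0 < J &
     forall phi, solutions_from H (K `\` A) phi -> (sup_j phi <= J%:E)%E) ->
  uniformly_globally_pre_asymptotically_stable H A.
Proof.
move=> lC pC lK hC hJ per.
have flow0 x : flow_set H x -> (flow_deriv H V x <= 0%:E)%E.
  by move=> /hC/le_trans; apply; rewrite lee_fin oppr_le0; exact: (pC x).1.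
pose L s := Num.max s (lambda s).
have jumpL x y : jump_set H x -> jump_map H x y -> V y <= L (V x).
  by move=> Dx xy; rewrite /L le_max (hJ x y)// orbT.
have est phi t j : is_solution H phi -> arc_dom phi (t, j) ->
    V (phi t j) <= iter j L (V (phi 0 0%N)).
  move=> s dtj; pose Q t j := V (phi t j) <= iter j L (V (phi 0 0%N)).
  suff h : forall t j, arc_dom phi (t, j) -> 0 <= t /\ Q t j.
    by have [] := h _ _ dtj.
  apply: arc_dom_ind; rewrite /Q //.
  - move=> a b i _ ab sub; apply: le_trans.
    exact: (flow_nonincreasing V_lyap flow0 s ab sub).
  - move=> u i _ d1 d2 h; have [Du ui] := sol_jump s d1 d2.
    apply: le_trans (jumpL _ _ Du ui) _; exact: max_class_Koo_le.
have jumps c : exists J, forall phi, is_solution H phi ->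
    0 < V (phi 0 0%N) <= c -> forall t j, arc_dom phi (t, j) -> (j <= J)%N.
  have [K nK Kc] := sublevel_solutions A_compact V_ge0 V_lyap V_proper c.
  have [J J0 hJ'] := per K nK; exists (Num.bound J) => phi s V0 t j dtj.
  have jJ : j%:R <= J.
    rewrite -lee_fin; apply: le_trans (hJ' phi (Kc phi s V0)).
    by apply: ereal_sup_ubound; exists (t, j).
  by rewrite -(ler_nat R); apply: (le_trans jJ); exact/ltW/archi_boundP/ltW.
have est' c J phi : is_solution H phi -> V (phi 0 0%N) <= c ->
    (forall t j, arc_dom phi (t, j) -> (j <= J)%N) ->
    forall t j, arc_dom phi (t, j) -> V (phi t j) <= iter J L c.
  move=> s Vc hJ' t j dtj; apply: le_trans (est _ _ _ s dtj) _.
  apply: le_trans (iter_max_leq lambda _ (hJ' t j dtj)) _.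
  exact: iter_max_le.
apply: (@uniformly_globally_pre_asymptotically_stable_of_estimates _ _ _ H A V) => //.
- move=> c; have [J hJ'] := jumps c; exists (iter J L c).
  move=> phi s V0c; have /andP[_ Vc] := V0c.
  exact: (est' c J phi s Vc (hJ' phi s V0c)).
- move=> e e0; have [J hJ'] := jumps 1; have [d d0 Ld] := iter_max_small lK J e0.
  exists (Num.min 1 d); first by rewrite lt_min ltr01.
  move=> phi s /andP[V0]; rewrite le_min => /andP[V1 Vd] t j dtj.
  apply: le_trans Ld; apply: (est' d J phi s Vd) dtj.
  by apply: hJ' => //; rewrite V0.
- move=> c e e0; have [J hJ'] := jumps c.
  have [c0|c0] := leP c 0.
    by exists 0 => phi s /andP[V0 Vc]; lra.
  (* Once [V] is below [r], the remaining jumps, at most [J], cannot lift it above [e]. *)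
  have [r r0 Lr] := iter_max_small lK J e0.
  pose B := iter J L c.
  have B0 : 0 < B by apply: lt_le_trans c0 (le_iter_max _ _ _).
  have [m m0 rC] := class_PD_lower_bound V_lyap V_proper B lC pC r0.
  (* The first term bounds the flow time while [V] is large, the second the number of jumps; the
     last makes the contradiction strict. *)
  exists (J.+1%:R * B / m + J%:R + 1) => phi s V0c t j dtj Ntj.
  have hJ0 := hJ' phi s V0c; have /andP[_ Vc] := V0c.
  have VB := est' c J phi s Vc hJ0.
  (* [B] bounds [V] at all times, hence also its increase at each jump. *)
  have dich : V (phi t j) <= iter j L r \/ m * t + V (phi t j) <= j.+1%:R * B.
    pose Q t j := arc_dom phi (t, j) ->
      V (phi t j) <= iter j L r \/ m * t + V (phi t j) <= j.+1%:R * B.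
    suff h : forall t j, arc_dom phi (t, j) -> 0 <= t /\ Q t j.
      by have [_] := h _ _ dtj; exact.
    apply: arc_dom_ind; rewrite /Q.
    + by move=> d0; right; rewrite mulr0 add0r mul1r; exact: VB.
    + move=> a b i a0 ab sub + db.
      have da : arc_dom phi (a, i) by apply: sub; rewrite /= in_itv/= lexx.
      move=> /(_ da); have mono := flow_nonincreasing V_lyap flow0 s ab sub.
      case=> [h|h]; first by left; lra.
      have [|br] := leP (V (phi b i)) (iter i L r); first by left.
      right; suff : V (phi b i) - V (phi a i) <= - m * (b - a) by lra.
      apply: (solution_flow_le Vlip s ab sub) => u uab.
      have [/ltW au /ltW ub] := andP uab.
      have Cu := solution_flow_set s sub uab.
      apply: le_trans (hC _ Cu) _; rewrite lee_fin lerN2.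
      apply: rC; first exact: flow_set_closure.
      have du : arc_dom phi (u, i) by apply: sub; rewrite /= in_itv/= au.
      rewrite VB// andbT; apply: le_trans (le_iter_max lambda i r) _.
      apply/ltW/(lt_le_trans br); apply: (flow_nonincreasing V_lyap flow0 s ub).
      move=> x; rewrite /= in_itv/= => /andP[ux xb].
      by apply: sub; rewrite /= in_itv/=; apply/andP; split; lra.
    + move=> u i u0 d1 d2 + _ => /(_ d1); have [Du ui] := sol_jump s d1 d2.
      case=> [h|h]; [left|right].
        by apply: le_trans (jumpL _ _ Du ui) _; exact: max_class_Koo_le.
      have := VB _ _ d2; have := V_ge0 (phi u i).
      by rewrite -/B -[i.+2%:R]natr1 mulrDl mul1r; lra.
  have jJ := hJ0 t j dtj; case: dich => [h|h].
    apply: (le_trans h); apply: le_trans Lr; exact: iter_max_leq.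
  have jB : j.+1%:R * B <= J.+1%:R * B.
    by rewrite ler_pM2r// ler_nat.
  have : t <= J.+1%:R * B / m.
    by rewrite ler_pdivlMr// mulrC; have := V_ge0 (phi t j); lra.
  have : j%:R <= J%:R :> R by rewrite ler_nat.
  lra.
- move=> phi s V0 t j dtj; apply/eqP; rewrite eq_le V_ge0 andbT.
  by apply: le_trans (est _ _ _ s dtj) _; rewrite V0 iter_max0.
Qed.

End cases.

Unset Implicit Arguments.

Theorem theoremV15 (R : realType) (n : nat) (M : C1manifold R n)
    (H : hybrid_system M) (A : set M) (A_neq0 : A !=set0) (A_compact : compact A)
    (V : M -> R) (V_ge0 : forall x, 0 <= V x)
    (V_lyap : lyapunov_candidate H [set: M] A [set: M] V)
    (V_proper : proper_function V)
    (V_cond :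
      (* (a) *)
      (exists rhoC rhoD : M -> R,
        [/\ lower_semicontinuous (EFin \o rhoC) /\ class_PD A rhoC,
            lower_semicontinuous (EFin \o rhoD) /\ class_PD A rhoD,
            forall x, flow_set H x -> (flow_deriv H V x <= (- rhoC x)%:E)%E
          & forall x, jump_set H x -> (jump_diff H V x <= (- rhoD x)%:E)%E])
      \/
      (* (b) *)
      (exists rhoC : M -> R,
        [/\ lower_semicontinuous (EFin \o rhoC) /\ class_PD A rhoC,
            forall x, flow_set H x -> (flow_deriv H V x <= (- rhoC x)%:E)%E,
            forall x, jump_set H x -> (jump_diff H V x <= 0%:E)%E
          & forall K : set M, compact_nbhd A K ->
            exists (gamma : R -> R) (N : R), [/\ class_Koo gamma, 0 <= N &
              forall phi, solutions_from H (K `\` A) phi ->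
              forall t j, arc_dom phi (t, j) -> gamma (t + j%:R) - N <= t]])
      \/
      (* (c) *)
      (exists rhoD : M -> R,
        [/\ lower_semicontinuous (EFin \o rhoD) /\ class_PD A rhoD,
            forall x, jump_set H x -> (jump_diff H V x <= (- rhoD x)%:E)%E,
            forall x, flow_set H x -> (flow_deriv H V x <= 0%:E)%E
          & forall K : set M, compact_nbhd A K ->
            exists (gamma : R -> R) (N : R), [/\ class_Koo gamma, 0 <= N &
              forall phi, solutions_from H (K `\` A) phi ->
              forall t j, arc_dom phi (t, j) -> gamma (t + j%:R) - N <= j%:R]])
      \/
      (* (d) *)
      (exists lc ld : R,
        [/\ forall x, flow_set H x -> (flow_deriv H V x <= (lc * V x)%:E)%E,
            forall x, jump_set H x ->
              (jump_diff H V x <= ((expR ld - 1) * V x)%:E)%E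
          & exists M0 gamma : R, [/\ 0 < M0, 0 < gamma &
              forall phi, is_solution H phi ->
              forall t j, arc_dom phi (t, j) ->
                lc * t + ld * j%:R <= M0 - gamma * (t + j%:R)]])
      \/
      (* (e) *)
      (exists (rhoD : M -> R) (lambda : R),
        [/\ lower_semicontinuous (EFin \o rhoD) /\ class_PD A rhoD,
            forall x, jump_set H x -> (jump_diff H V x <= (- rhoD x)%:E)%E,
            forall x, flow_set H x -> (flow_deriv H V x <= (lambda * V x)%:E)%E
          & forall K : set M, compact_nbhd A K ->
            exists2 T : R, 0 <= T &
              forall phi, solutions_from H (K `\` A) phi ->
                (sup_t phi <= T%:E)%E])
      \/
      (* (f) *)
      (exists (rhoC : M -> R) (lambda : R -> R),
        [/\ lower_semicontinuous (EFin \o rhoC) /\ class_PD A rhoC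
              /\ class_Koo lambda,
            forall x, flow_set H x -> (flow_deriv H V x <= (- rhoC x)%:E)%E,
            forall x chi, jump_set H x -> jump_map H x chi ->
              V chi <= lambda (V x)
          & forall K : set M, compact_nbhd A K ->
            exists2 J : R, 0 < J &
              forall phi, solutions_from H (K `\` A) phi ->
                (sup_j phi <= J%:E)%E])) :
  uniformly_globally_pre_asymptotically_stable H A.
Proof.
case: V_cond => [[rhoC [rhoD [[lC pC] [lD pD] hC hD]]]|].
  exact: (stable_strict_decrease A_compact V_ge0 V_lyap V_proper lC pC lD pD hC hD).
case=> [[rhoC [[lC pC] hC hD per]]|].
  exact: (stable_flow_decrease A_compact V_ge0 V_lyap V_proper lC pC hC hD per).
case=> [[rhoD [[lD pD] hD hC per]]|].
  exact: (stable_jump_decrease A_compact V_ge0 V_lyap V_proper lD pD hD hC per).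
case=> [[lc [ld [hC hD [M0 [gamma [M0_gt0 gamma_gt0 per]]]]]]|].
  exact: (stable_balanced A_compact V_ge0 V_lyap V_proper hC hD M0_gt0 gamma_gt0 per).
case=> [[rhoD [l [[lD pD] hD hC per]]]|].
  exact: (stable_bounded_flow_time A_compact V_ge0 V_lyap V_proper lD pD hD hC per).
move=> [rhoC [lambda [[lC [pC lK]] hC hJ per]]].
exact: (stable_bounded_jumps A_compact V_ge0 V_lyap V_proper lC pC lK hC hJ per).
Qed.
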